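(* (Approximate ratio approach.) In the deep inverse Rosenblatt transport (DIRT) setting described in the context, let $k\ge1$ and for $j=1,\ldots,k$ let $$\tilde q_j(u)=\left(\frac{(r_{j,j-1}\circ\bar T_{j-1})(u)\,f_U(u)}{\omega(u)}\right)^{1/2},\qquad u\in\mathcal U,\qquad r_{j,j-1}=\frac{\pi_j}{\pi_{j-1}} .$$ Suppose $$\|\tilde g_0-\sqrt{\pi_0}\|_{L^2_\lambda(\mathcal X)}\le\epsilon_0,\qquad \gamma_0\le\frac1{\lambda(\mathcal X)}\|\tilde g_0-\sqrt{\pi_0}\|^2_{L^2_\lambda(\mathcal X)},$$ and for $j=1,\ldots,k$ $$\|\tilde g_j-\tilde q_j\|_{L^2_\omega(\mathcal U)}\le\epsilon_j,\qquad \gamma_j\le\frac1{\omega(\mathcal U)}\|\tilde g_j-\tilde q_j\|^2_{L^2_\omega(\mathcal U)} .$$ Then $$\big\|\sqrt{\pi_k}-\sqrt{\hat\pi_k}\big\|_{L^2_\lambda(\mathcal X)}\le\sqrt{2\,c_{k,0}}\;\epsilon_0+\sum_{j=1}^k\sqrt{2\,c_{k,j}\,\bar z_{j-1}}\;\epsilon_j,$$ where $c_{k,j}=\sup_{x\in\mathcal X}\pi_k(x)/\pi_j(x)$ and $\bar z_{j}=\prod_{i=0}^{j}\hat z_i$.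
   Context: Spaces and weights: $\mathcal X=\prod_{i=1}^d\mathcal X_i$, $\mathcal U=\prod_{i=1}^d\mathcal U_i$ with $\mathcal X_i,\mathcal U_i\subseteq\mathbb R$; $\lambda(x)=\prod_i\lambda_i(x_i)$ and $\omega(u)=\prod_i\omega_i(u_i)$ are product weight functions (positive), with $\lambda(\mathcal X)=\int_{\mathcal X}\lambda$ and $\omega(\mathcal U)=\int_{\mathcal U}\omega$ finite. $\|f\|_{L^2_\lambda(\mathcal X)}^2=\int_{\mathcal X}f^2\lambda\,dx$ and $\|g\|_{L^2_\omega(\mathcal U)}^2=\int_{\mathcal U}g^2\omega\,du$. Reference: $\mu$ is a product probability measure on $\mathcal U$ with density $f_U(u)=\prod_i f_{U_i}(u_i)>0$; $R(u)=(F_{U_1}(u_1),\ldots,F_{U_d}(u_d))$ is the map of its marginal cumulative distribution functions, so $R_\sharp\mu=\mu_{\rm uni}$, the uniform measure on $[0,1]^d$. Bridging densities: $\pi_0,\ldots,\pi_L$ are nonnegative unnormalised densities on $\mathcal X$ with $z_k=\int_{\mathcal X}\pi_k\lambda\,dx\in(0,\infty)$. Standing assumption: for every $j<k$ the ratio $r_{k,j}(x)=\pi_k(x)/\pi_j(x)$ is well defined (the denominators do not vanish) and $c_{k,j}=\sup_{x\in\mathcal X}r_{k,j}(x)<\infty$; for $j=k$, $r_{k,k}\equiv1$ and $c_{k,k}=1$. The inverse Rosenblatt transport of a density $p$ on a product domain is the inverse of the lower-triangular map $(F_1(x_1),F_2(x_2|x_1),\ldots,F_d(x_d|x_{1},\ldots,x_{d-1}))$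 of its marginal/conditional cumulative distribution functions; it pushes $\mu_{\rm uni}$ forward to the measure with density $p$. DIRT: Layer $0$: $\tilde g_0:\mathcal X\to\mathbb R$ is a tensor-train function (product of univariate matrix-valued functions $\mathsf G_1(x_1)\cdots\mathsf G_d(x_d)$, a scalar), $\gamma_0>0$, $\hat z_0=\gamma_0\lambda(\mathcal X)+\int_{\mathcal X}\tilde g_0^2\lambda\,dx$, and $\hat T_0:[0,1]^d\to\mathcal X$ is the inverse Rosenblatt transport of $\hat f_0(x)=\frac1{\hat z_0}(\gamma_0+\tilde g_0(x)^2)\lambda(x)$. Layers $j\ge1$: $\tilde g_j:\mathcal U\to\mathbb R$ is a tensor-train function, $\gamma_j>0$, $\hat z_j=\gamma_j\omega(\mathcal U)+\int_{\mathcal U}\tilde g_j^2\omega\,du$, and $\hat T_j:[0,1]^d\to\mathcal U$ is the inverse Rosenblatt transport of $\hat p_j(u)=\frac1{\hat z_j}(\gamma_j+\tilde g_j(u)^2)\omega(u)$. The composition is $\bar T_j=(\hat T_0\circ R)\circ(\hat T_1\circ R)\circ\cdots\circ(\hat T_j\circ R):\mathcal U\to\mathcal X$. The maps are treated as diffeomorphisms (up to null sets), so the change of variables formula for densities applies. Approximate densities: with $\bar z_k=\prod_{j=0}^k\hat z_j$, $$\hat\pi_k(x)=\big(\gamma_0+\tilde g_0(x)^2\big)\prod_{j=1}^k\frac{\big(\gamma_j+(\tilde g_j\circ\bar T_{j-1}^{-1})(x)^2\big)\,(\omega\circ\bar T_{j-1}^{-1})(x)}{(f_U\circ\bar T_{j-1}^{-1})(x)}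 ,$$ and $(\bar T_k)_\sharp\mu$ has the density $\frac1{\bar z_k}\hat\pi_k(x)\lambda(x)$. *)

(* Defs.v *)
From HB Require Import structures.
From mathcomp Require Import all_boot all_order all_algebra.
From mathcomp Require Import all_classical all_reals all_analysis.

Set Implicit Arguments.
Unset Strict Implicit.
Unset Printing Implicit Defensive.
Import Order.TTheory GRing.Theory Num.Theory.
Import numFieldNormedType.Exports.
Local Open Scope classical_set_scope.
Local Open Scope ring_scope.

(* R^d with its product Borel sigma-algebra. *)
Notation Rn R d := (d.-tuple (measurableTypeR R)).

Section lebesgue_measure_Rn.
Context (R : realType).

Definition Rn_cons n (z : measurableTypeR R * Rn R n) : Rn R n.+1 :=
  [tuple of z.1 :: z.2].

Lemma measurable_Rn_cons n : measurable_fun [set: _] (@Rn_cons n).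
Proof.
exact: (@measurable_cons _ _ _ (measurableTypeR R)).
Qed.

Let Rn_uncons n (x : Rn R n.+1) : measurableTypeR R * Rn R n :=
  (thead x, [tuple of behead x]).

Let measurable_Rn_uncons n : measurable_fun [set: _] (@Rn_uncons n).
Proof.
apply/measurable_fun_pair; last exact: measurable_behead.
exact: (@measurable_tnth _ (measurableTypeR R) _ ord0).
Qed.

Let Rn_consK n : cancel (@Rn_cons n) (@Rn_uncons n).
Proof. by case=> a t; congr pair; apply/val_inj. Qed.

Section step.
Context n (m : {sigma_finite_measure set (Rn R n) -> \bar R}).

Definition Rn_step : set (Rn R n.+1) -> \bar R :=
  pushforward (@lebesgue_measure R \x m)%E (@Rn_cons n).

Let prodm : {measure set (measurableTypeR R * Rn R n) -> \bar R} :=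
  (@lebesgue_measure R \x m)%E.

Let preim A : measurable A -> measurable (@Rn_cons n @^-1` A).
Proof. by move=> mA; rewrite -[X in measurable X]setTI; exact: measurable_Rn_cons. Qed.

Let Rn_step0 : Rn_step set0 = 0%E.
Proof. by rewrite /Rn_step /pushforward preimage_set0; exact: (measure0 prodm). Qed.

Let Rn_step_ge0 A : (0 <= Rn_step A)%E.
Proof. exact: (measure_ge0 prodm). Qed.

Let Rn_step_sigma_additive : semi_sigma_additive Rn_step.
Proof.
move=> F mF tF mUF; rewrite /Rn_step /pushforward preimage_bigcup.
apply: (@measure_semi_sigma_additive _ _ _ prodm).
- by move=> i; exact: preim.
- apply/trivIsetP => /= i j _ _ ij; rewrite -preimage_setI.
  by move/trivIsetP : tF => /(_ _ _ _ _ ij) ->//; rewrite preimage_set0.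
- by rewrite -preimage_bigcup; exact: preim.
Qed.

HB.instance Definition _ := isMeasure.Build _ _ _ Rn_step
  Rn_step0 Rn_step_ge0 Rn_step_sigma_additive.

Let Rn_step_sigma_finite : sigma_finite setT Rn_step.
Proof.
have /sigma_finiteP[F [TF ndF Foo]] := sigma_finiteT (@lebesgue_measure R).
have /sigma_finiteP[G [TG ndG Goo]] := sigma_finiteT m.
exists (fun k => @Rn_uncons n @^-1` (F k `*` G k)).
  rewrite -preimage_bigcup (_ : \bigcup_k _ = setT) ?preimage_setT//.
  rewrite -setXTT TF TG predeqE => -[x y]; split.
    by move=> [k _ []/= ? ?]; split; exists k.
  move=> [/= [k _ Fkx] [l _ Gly]]; exists (maxn k l) => //; split.
  - by move: x Fkx; exact/subsetPset/ndF/leq_maxl.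
  - by move: y Gly; exact/subsetPset/ndG/leq_maxr.
move=> k; have [mF Fk] := Foo k; have [mG Gk] := Goo k; split.
  by rewrite -[X in measurable X]setTI; apply: measurable_Rn_uncons => //;
    exact: measurableX.
rewrite /Rn_step /pushforward -comp_preimage (_ : _ \o _ = id); last first.
  by apply/funext => z; exact: Rn_consK.
by rewrite preimage_id product_measure1E// lte_mul_pinfty// ge0_fin_numE.
Qed.

HB.instance Definition _ :=
  Measure_isSigmaFinite.Build _ _ _ Rn_step Rn_step_sigma_finite.
End step.

Fixpoint lebesgue_Rn n : {sigma_finite_measure set (Rn R n) -> \bar R} :=
  match n with
  | 0 => [the {sigma_finite_measure set (Rn R 0) -> \bar R} of \d_([tuple] : Rn R 0)]
  | n'.+1 => [the {sigma_finite_measure set (Rn R n'.+1) -> \bar R} of Rn_step (lebesgue_Rn n')]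
  end.
End lebesgue_measure_Rn.

Section domains_and_weights.
Context (R : realType) (d : nat).
Implicit Types (D : set (Rn R d)) (w f : Rn R d -> R).

Definition box (E : 'I_d -> set R) : set (Rn R d) :=
  [set x | forall i, E i (tnth x i)].

Definition unit_cube : set (Rn R d) := box (fun=> `[0, 1]%classic).

Definition prod_fun (h : 'I_d -> R -> R) (x : Rn R d) : R :=
  \prod_(i < d) h i (tnth x i).

Definition mass D w : R := \int[lebesgue_Rn R d]_(x in D) w x.

Definition L2norm D w f : \bar R :=
  sqrte (\int[lebesgue_Rn R d]_(x in D) (f x ^+ 2 * w x)%:E)%E.

Definition product_weight (E : 'I_d -> set R) (h : 'I_d -> R -> R) : Prop :=
  [/\ forall i, measurable (E i),
      forall i, measurable_fun (E i) (h i),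
      forall i t, E i t -> 0 < h i t &
      (\int[lebesgue_Rn R d]_(x in box E) (prod_fun h x)%:E < +oo)%E].

(* The factors are the marginal densities, hence each is normalised. *)
Definition product_probability_density
    (E : 'I_d -> set R) (h : 'I_d -> R -> R) : Prop :=
  [/\ forall i, measurable_fun (E i) (h i),
      forall i t, E i t -> 0 < h i t &
      forall i, (\int[lebesgue_measure]_(t in E i) (h i t)%:E = 1)%E].

End domains_and_weights.

Lemma measurable_box (R : realType) n (E : 'I_n -> set R) :
  (forall i, measurable (E i)) -> measurable (box E).
Proof.
move=> mE; rewrite (_ : box E = \bigcap_(i in [set: 'I_n]) [set x : Rn R n | E i (tnth x i)]).
  apply: fin_bigcap_measurable => // i _.
  rewrite -[X in measurable X]setTI. exact: (@measurable_tnth _ (measurableTypeR R) n i measurableT _ (mE i)).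
by apply/seteqP; split => x /= h i; [move=> _; exact: h|exact: h].
Qed.
Lemma lebesgue_Rn_box (R : realType) n (E : 'I_n -> set R) :
  (forall i, measurable (E i)) ->
  lebesgue_Rn R n (box E) = (\prod_(i < n) lebesgue_measure (E i))%E.
Proof.
elim: n E => [|n IH] E mE.
  by rewrite big_ord0 /= diracE mem_set// => -[].
rewrite big_ord_recl /= /Rn_step /pushforward.
rewrite -IH// (_ : _ @^-1` _ = E ord0 `*` box (fun i => E (lift ord0 i))).
  rewrite product_measure1E; [by []|exact: mE|]. by apply: (@measurable_box R n) => i; exact: mE.
apply/seteqP; split=> -[t y] /=.
  move=> h; split; first exact: (h ord0).
  by move=> i; have := h (lift ord0 i); rewrite tnthS.
move=> [h1 h2] i; case: (unliftP ord0 i) => [j ->|->] //.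
by rewrite tnthS; exact: h2.
Qed.

Section transports.
Context (R : realType).

Definition density_cdf (p : R -> R) (x : R) : R :=
  \int[lebesgue_measure]_(t in `]-oo, x]) p t.

Definition marginal_cdfs d (E : 'I_d -> set R) (h : 'I_d -> R -> R)
    (u : Rn R d) : Rn R d :=
  [tuple density_cdf (h i \_ (E i)) (tnth u i) | i < d].

Definition first_marginal n (p : Rn R n.+1 -> R) (t : R) : R :=
  \int[lebesgue_Rn R n]_y p (Rn_cons (t, y)).

Definition conditional n (p : Rn R n.+1 -> R) (t : R) (y : Rn R n) : R :=
  p (Rn_cons (t, y)) / first_marginal p t.

(* The map (F_1(x_1), F_2(x_2|x_1), ..., F_d(x_d|x_1,...,x_(d-1))) of a
   probability density p on the whole of R^d: F_1 is the distribution function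
   of the first marginal, and the remaining coordinates are those of the map of
   the conditional density of (x_2,...,x_d) given x_1. *)
Fixpoint rosenblatt n : (Rn R n -> R) -> Rn R n -> Rn R n :=
  match n return (Rn R n -> R) -> Rn R n -> Rn R n with
  | 0 => fun _ x => x
  | n'.+1 => fun p x =>
      Rn_cons (density_cdf (first_marginal p) (thead x),
               rosenblatt (conditional p (thead x)) [tuple of behead x])
  end.

(* g : B -> A is a measurable inverse of f : A -> B up to null sets. *)
Definition ae_inverse d (A B : set (Rn R d)) (f g : Rn R d -> Rn R d) : Prop :=
  [/\ measurable_fun B g,
      g @` B `<=` A,
      {ae lebesgue_Rn R d, forall x, A x -> g (f x) = x} &
      {ae lebesgue_Rn R d, forall y, B y -> f (g y) = y}].

Definition inverse_rosenblatt d (D : set (Rn R d)) (p : Rn R d -> R)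
    (T : Rn R d -> Rn R d) : Prop :=
  ae_inverse D (@unit_cube R d) (rosenblatt (p \_ D)) T.

Fixpoint tt_product (r : nat -> nat) (G : forall i, R -> 'M[R]_(r i, r i.+1))
    d (x : seq R) : 'M[R]_(r 0, r d) :=
  match d with
  | 0 => 1%:M
  | i.+1 => tt_product G i x *m G i x`_i
  end.

(* g(x) = G_1(x_1) ... G_d(x_d), where the outer ranks r 0 and r d are 1 *)
Definition tensor_train d (D : set (Rn R d)) (g : Rn R d -> R) : Prop :=
  exists (r : nat -> nat) (r0 : r 0 = 1%N) (rd : r d = 1%N)
         (G : forall i, R -> 'M[R]_(r i, r i.+1)),
    forall x, D x -> g x = castmx (r0, rd) (tt_product G d (x : seq R)) ord0 ord0.

End transports.

Section dirt.
Context (R : realType) (d : nat).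
Implicit Types (D X U : 'I_d -> set R) (lam om fU : 'I_d -> R -> R).
Implicit Types (pi g : nat -> Rn R d -> R) (gam : nat -> R).
Implicit Types (T S : nat -> Rn R d -> Rn R d).

Definition bridge_ratio pi (k j : nat) (x : Rn R d) : R :=
  if k == j then 1 else pi k x / pi j x.

Definition bridge_sup X pi (k j : nat) : R :=
  sup [set bridge_ratio pi k j x | x in box X].

Definition bridging_densities X lam pi (L : nat) : Prop :=
  [/\ forall k, (k <= L)%N -> measurable_fun (box X) (pi k),
      forall k x, (k <= L)%N -> box X x -> 0 <= pi k x,
      forall k, (k <= L)%N ->
        (0 < \int[lebesgue_Rn R d]_(x in box X) (pi k x * prod_fun lam x)%:E
           < +oo)%E,
      forall j x, (j < L)%N -> box X x -> pi j x != 0 &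
      forall j k, (j < k <= L)%N ->
        has_ubound [set bridge_ratio pi k j x | x in box X]].

Definition layer_mass D (w : 'I_d -> R -> R) (c : R) (h : Rn R d -> R) : R :=
  c * mass (box D) (prod_fun w) +
  \int[lebesgue_Rn R d]_(x in box D) (h x ^+ 2 * prod_fun w x).

Definition layer_density D (w : 'I_d -> R -> R) (c : R) (h : Rn R d -> R)
    (x : Rn R d) : R :=
  (layer_mass D w c h)^-1 * ((c + h x ^+ 2) * prod_fun w x).

Definition dirt_layer D (w : 'I_d -> R -> R) (c : R) (h : Rn R d -> R)
    (t : Rn R d -> Rn R d) : Prop :=
  [/\ tensor_train (box D) h, measurable_fun (box D) h, 0 < c &
      inverse_rosenblatt (box D) (layer_density D w c h) t].

Fixpoint dirt_map U fU T (j : nat) : Rn R d -> Rn R d :=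
  match j with
  | 0 => T 0%N \o marginal_cdfs U fU
  | i.+1 => dirt_map U fU T i \o (T i.+1 \o marginal_cdfs U fU)
  end.

(* z_0 z_1 ... z_j for the normalising constants z_i of the layers *)
Definition dirt_mass X U lam om gam g (j : nat) : R :=
  layer_mass X lam (gam 0%N) (g 0%N) *
  \prod_(1 <= i < j.+1) layer_mass U om (gam i) (g i).

(* S j stands for the inverse of dirt_map U fU T j *)
Definition dirt_density om fU gam g S (k : nat) (x : Rn R d) : R :=
  (gam 0%N + g 0%N x ^+ 2) *
  \prod_(1 <= j < k.+1)
     ((gam j + g j (S j.-1 x) ^+ 2) * prod_fun om (S j.-1 x)
        / prod_fun fU (S j.-1 x)).

Definition ratio_target U om fU pi T (j : nat) (u : Rn R d) : R :=
  Num.sqrt (bridge_ratio pi j j.-1 (dirt_map U fU T j.-1 u) * prod_fun fU u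
              / prod_fun om u).

End dirt.

(* Main.v *)
(* With r = pi_k / pi_j and pihat_j the approximate densities, the error telescopes:
     sqrt pi_k - sqrt pihat_k = sqrt r_(k,0) (sqrt pi_0 - sqrt pihat_0)
       + sum_j sqrt r_(k,j) sqrt pihat_(j-1) (sqrt r_(j,j-1) - sqrt qhat_j),
   where pihat_j = pihat_(j-1) qhat_j. The factor r_(k,j) costs c_(k,j). Since the
   composed map pushes mu forward to the density pihat_(j-1) lambda / zbar_(j-1), the
   norm of the rest of the j-th term becomes zbar_(j-1)^(1/2) times the L2 distance
   on U between the target q_j and sqrt (gamma_j + g_j^2), which is at most
   sqrt 2 eps_j because (q - sqrt (gamma + g^2))^2 <= (q - g)^2 + gamma.
   The push-forward property of one layer comes from the forward statement: the
   Rosenblatt map of any probability density sends it to the uniform measure on the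
   cube (probability integral transform and Tonelli, by induction on the dimension),
   and T inverts that map almost everywhere. *)

Require Import Defs.
From HB Require Import structures.
From mathcomp Require Import all_boot all_order all_algebra.
From mathcomp Require Import all_classical all_reals all_analysis.
From mathcomp Require Import measurable_realfun ring lra.
Import Order.TTheory GRing.Theory Num.Theory.
Import numFieldNormedType.Exports.
Local Open Scope classical_set_scope.
Local Open Scope ring_scope.

Set Implicit Arguments.
Unset Strict Implicit.

(** Changes of variables are stated as integral identities for nonnegative measurable test
    functions, so no Jacobian appears and a map needs an inverse only up to Lebesgue null sets. The
    reference map R falls under the same forward statement, because on its box it is the Rosenblatt
    map of a product density. A conditional density divides by a marginal that may vanish or be
    infinite; such slices form a null set or carry no mass of the joint density, so the default
    values chosen there are harmless. In the composition, the induction absorbs the factor of the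
    last layer into the test function. Each almost everywhere inversion is then used directly under
    an integral over U, and no null set has to be transported through a map. The error at stage m is
    carried with the weight sqrt r_(k,m). With the bare error, each step would multiply the earlier
    terms by a further c_(m+1,m), instead of leaving c_(k,j) in the j-th term. The 2 in the
    constants counts two contributions of at most eps_j^2: the squared approximation error, and
    gamma_j times the total weight. *)

Section measurability.
Context d (T : measurableType d) (R : realType).

Lemma measurable_fun_apply2 d1 d2 d3 (T1 : measurableType d1) (T2 : measurableType d2)
    (T3 : measurableType d3) (q : T1 -> T2 -> T3) (f : T -> T1) (g : T -> T2) :
  measurable_fun setT (fun z : T1 * T2 => q z.1 z.2) ->
  measurable_fun setT f -> measurable_fun setT g ->
  measurable_fun setT (fun x => q (f x) (g x)).
Proof.
move=> mq mf mg; have mfg := measurable_fun_pair mf mg.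
exact: (measurableT_comp mq mfg).
Qed.

Lemma measurable_inv : measurable_fun setT (@GRing.inv R).
Proof.
have m0 : measurable_fun setT (fun x : R => x != 0).
  apply: (measurable_fun_bool false) => //.
  rewrite setTI (_ : _ @^-1` _ = [set 0]) //; apply/seteqP.
  by split => x /=; [move/negbFE/eqP|move=> ->; rewrite eqxx].
(* Since 0^-1 = 0 by convention, inversion is a continuous function on the open complement of 0,
   patched by the constant 0. *)
rewrite (_ : @GRing.inv R = fun x => if x != 0 then x^-1 else 0); last first.
  by apply/funext => x; case: eqVneq => // ->; rewrite invr0.
apply: (measurable_fun_if measurableT m0) => //.
rewrite setTI; apply: open_continuous_measurable_fun.
  rewrite (_ : _ @^-1` _ = ~` [set 0]); first exact/closed_openC/closed_eq.
  by apply/seteqP; split => x /=; [move=> /eqP|move/eqP].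
by move=> x; rewrite inE /= => x0; exact: inv_continuous.
Qed.

Lemma measurable_sqrt : measurable_fun setT (@Num.sqrt R).
Proof. by apply: nondecreasing_measurable => // x y xy; exact: ler_wsqrtr. Qed.

End measurability.

(** * Measures with a density and the probability integral transform *)

Section density_measure.
Context d (T : measurableType d) (R : realType).
Variables (mu : {measure set T -> \bar R}) (p : T -> R).
Hypotheses (mp : measurable_fun setT p) (p0 : forall x, 0 <= p x).

(* The hypotheses are arguments so that the measure structure can be attached
   to the constant. *)
Definition density_measure of measurable_fun setT p & (forall x, 0 <= p x) :=
  fun A : set T => (\int[mu]_(x in A) (p x)%:E)%E.

Local Notation nu := (density_measure mp p0).

Let nu0 : nu set0 = 0%E.
Proof. by rewrite /density_measure integral_set0. Qed.

Let nu_ge0 A : (0 <= nu A)%E.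
Proof. by apply: integral_ge0 => x _; rewrite lee_fin. Qed.

Let nu_sigma_additive : semi_sigma_additive nu.
Proof.
move=> /= F mF tF mUF; rewrite /density_measure; apply: cvg_toP.
  apply: ereal_nondecreasing_is_cvgn => m n mn.
  apply: lee_sum_nneg_natr => // k _ _.
  by apply: integral_ge0 => /= x Fkx; rewrite lee_fin.
rewrite ge0_integral_bigcup//=.
- by apply: measurable_funTS; exact/measurable_EFinP.
- by move=> x _; rewrite lee_fin.
Qed.

HB.instance Definition _ := isMeasure.Build _ _ _ nu
  nu0 nu_ge0 nu_sigma_additive.

Import HBNNSimple.

Let mpE D : measurable_fun D (EFin \o p).
Proof. by apply: measurable_funTS; exact/measurable_EFinP. Qed.

Let integral_density_nnsfun (h : {nnsfun T >-> R}) :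
  (\int[nu]_x (h x)%:E = \int[mu]_x ((h x)%:E * (p x)%:E))%E.
Proof.
under [LHS]eq_integral do rewrite fimfunE -fsumEFin//.
rewrite [LHS]ge0_integral_fsum//; last 2 first.
  - by move=> r; exact/measurable_EFinP/measurableT_comp.
  - by move=> n x _; rewrite EFinM nnfun_muleindic_ge0.
under [RHS]eq_integral.
  move=> x xD; rewrite fimfunE -fsumEFin// ge0_mule_fsuml; last first.
    by move=> r; rewrite EFinM nnfun_muleindic_ge0.
  over.
rewrite [RHS]ge0_integral_fsum//; last 2 first.
  - move=> r; apply: emeasurable_funM; last exact: mpE.
    by apply/measurable_EFinP; exact/measurableT_comp.
  - by move=> n x _; rewrite mule_ge0 ?lee_fin// -lee_fin EFinM nnfun_muleindic_ge0.
apply: eq_fsbigr => r _; rewrite integralZl_indic_nnsfun//= integral_indic//= setIT.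
(* A negative [r] has an empty fibre, so both sides vanish; the scalar can be pulled out of the
   integral only when it is nonnegative. *)
have [r0|r0] := ltP r 0.
  rewrite preimage_nnfun0// measure0 mule0; apply/esym.
  by apply: integral0_eq => x _; rewrite indic0 mulr0 mul0e.
transitivity (\int[mu]_x (r%:E * ((\1_(h @^-1` [set r]) x)%:E * (p x)%:E)))%E; last first.
  by apply: eq_integral => x _; rewrite EFinM muleA.
rewrite ge0_integralZl//; last 2 first.
- apply: emeasurable_funM; last exact: mpE.
  by apply/measurable_EFinP; exact: measurable_indic.
- by move=> x _; rewrite mule_ge0 ?lee_fin.
congr (_ * _)%E; rewrite /density_measure integral_mkcond; apply: eq_integral => x _.
by rewrite patchE indicE; case: ifPn => _; rewrite ?mul1e ?mul0e.
Qed.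

(** Simple functions increase to [f], and monotone convergence applies under both measures. *)
Lemma integral_density_measure (f : T -> \bar R) :
  measurable_fun setT f -> (forall x, 0 <= f x)%E ->
  (\int[nu]_x f x = \int[mu]_x (f x * (p x)%:E))%E.
Proof.
move=> mf f0; pose f_ := nnsfun_approx measurableT mf.
have f_cvg x : (f_ n x)%:E @[n --> \oo] --> f x by exact: cvg_nnsfun_approx.
transitivity (lim (\int[nu]_x (f_ n x)%:E @[n --> \oo])%E).
  rewrite -monotone_convergence//=.
  - by apply: eq_integral => x _; apply/esym/cvg_lim.
  - by move=> n; exact/measurable_EFinP/measurable_funTS.
  - by move=> n x _; rewrite lee_fin.
  - by move=> x _ m n mn; rewrite lee_fin; exact/lefP/nd_nnsfun_approx.
transitivity (lim (\int[mu]_x ((f_ n x)%:E * (p x)%:E) @[n --> \oo])%E).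
  by apply: congr_lim; apply/funext => n /=; exact: integral_density_nnsfun.
rewrite -monotone_convergence//=.
- apply: eq_integral => x _; apply/cvg_lim => //.
  by apply: cvgeZr => //; exact: f_cvg.
- move=> n; apply: emeasurable_funM; last exact: mpE.
  exact/measurable_EFinP/measurable_funTS.
- by move=> n x _; rewrite mule_ge0// lee_fin.
- move=> x _ m n mn; rewrite lee_wpmul2r ?lee_fin//.
  exact/lefP/nd_nnsfun_approx.
Qed.

End density_measure.

(** * The probability integral transform of a law without atoms *)

Section atomless_cdf.
Context (R : realType) (P : probability (measurableTypeR R) R).
Hypothesis atomless : forall x, P [set x] = 0%E.
Local Open Scope measure_display_scope.

(** The identity seen as a random variable, so that monotonicity and the limits of [cdf] apply to
    [P] itself. *)
Let idTR : measurableTypeR R -> R := idfun.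

#[local] HB.instance Definition _ :=
  @isMeasurableFun.Build _ _ _ _ idTR (@measurable_id _ _ setT).

Let G : R -> \bar R := cdf (idTR : {RV P >-> R}).

Let F (x : R) : R := fine (P `]-oo, x]%classic).

Let PF x : P `]-oo, x]%classic = (F x)%:E.
Proof. by rewrite /F fineK// fin_num_measure. Qed.

Let GF x : G x = (F x)%:E.
Proof. exact: PF. Qed.

Let F_nd : {homo F : x y / x <= y}.
Proof. by move=> x y xy; rewrite -lee_fin -!GF cdf_nondecreasing. Qed.

Let mF D : measurable_fun D F.
Proof.
by apply: measurable_funTS; apply: nondecreasing_measurable => //.
Qed.

Let mFray y : (measurable (F @^-1` `]-oo, y]%classic) : Prop).
Proof. by rewrite -[X in measurable X]setTI; exact: mF. Qed.

(** The set where F is at most y is a lower set, so it lies between the open and the closed ray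
    ending at its supremum s. These rays have equal mass because s is not an atom, and continuity of
    the measure from both sides of s shows that this mass is y. With y < 1 the set is bounded above,
    as F tends to 1. *)
Let cdf_ray_le y : 0 <= y < 1 -> P (F @^-1` `]-oo, y]%classic) = y%:E.
Proof.
move=> /andP[y0 y1]; set A := F @^-1` _.
have [A0|/set0P A0] := eqVneq A set0.
  (* If the set is empty, F exceeds y everywhere, and its limit 0 at minus infinity forces y = 0. *)
  suff -> : y = 0 by rewrite A0 measure0.
  apply/eqP; rewrite eq_le y0 andbT -lee_fin.
  apply: (cvge_to_ge (cvg_cdfNy0 (idTR : {RV P >-> R}))).
  near=> x; rewrite -/(G x) GF lee_fin leNgt; apply/negP => Fxy.
  have : A x by rewrite /A /= in_itv /= ltW.
  by rewrite A0.
have [b yFb] : exists b, y < F b.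
  apply: contrapT => /forallNP yF.
  suff : (1%:E <= y%:E)%E by rewrite lee_fin leNgt y1.
  apply: (cvge_to_le (cvg_cdfy1 (idTR : {RV P >-> R}))).
  near=> x; rewrite -/(G x) GF lee_fin leNgt; apply/negP; exact: yF.
have supA : has_sup A.
  split => //; exists b => x; rewrite /A /= in_itv /= => Fx.
  by rewrite leNgt; apply/negP => /ltW /F_nd; rewrite leNgt (le_lt_trans Fx).
pose s := sup A.
have Ale : A `<=` `]-oo, s]%classic.
  by move=> x Ax; rewrite /= in_itv /=; apply: ub_le_sup => //; case: supA.
have Age : `]-oo, s[%classic `<=` A.
  move=> x; rewrite /= in_itv /= => /sup_gt [|a Aa xa]; first by case: supA.
  move: Aa; rewrite /A /= !in_itv /=; apply: le_trans; exact/F_nd/ltW.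
have Ps : P `]-oo, s]%classic = P `]-oo, s[%classic.
  rewrite -(setUitv1 true)// measureU//; first by rewrite [X in (_ + X)%E](atomless s) adde0.
  by apply/seteqP; split => // x /= [] /[swap] ->; rewrite in_itv /= ltxx.
(* From the right: F (s + 1/(k+1)) > y because this point lies beyond the supremum. *)
have Pge : (y%:E <= P `]-oo, s]%classic)%E.
  rewrite (itvNycEbigcap false).
  have := @nonincreasing_cvg_mu _ _ _ P (fun k => `]-oo, (s + k.+1%:R^-1)%R]%classic).
  move=> /(_ _ _ _ _)/cvge_to_ge; apply => //.
  - by rewrite -ge0_fin_numE// fin_num_measure.
  - exact: bigcap_measurable.
  - move=> m n mn; apply/subsetPset/subset_itvl; rewrite bnd_simp lerD2l.
    by rewrite lef_pV2 ?posrE// ler_nat.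
  - near=> k; rewrite /= PF lee_fin leNgt; apply/negP => /ltW Fy.
    have /Ale : A (s + k.+1%:R^-1) by rewrite /A /= in_itv.
    by rewrite /= in_itv /= leNgt ltrDl invr_gt0 ltr0n.
(* From the left, through complements: F (s - 1/(k+1)) <= y because this point belongs to the
   set. *)
have Ple : (P `]-oo, s[%classic <= y%:E)%E.
  have PC : P `]-oo, s[%classic = (1 - P `[s, +oo[%classic)%E.
    by rewrite -probability_setC// setCitvr.
  rewrite PC leeBlDr ?fin_num_measure// -leeBlDl//.
  rewrite itvcyEbigcap.
  have := @nonincreasing_cvg_mu _ _ _ P (fun k => `](s - k.+1%:R^-1)%R, +oo[%classic).
  move=> /(_ _ _ _ _)/cvge_to_ge; apply => //.
  - by rewrite -ge0_fin_numE// fin_num_measure.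
  - exact: bigcap_measurable.
  - move=> m n mn; apply/subsetPset/subset_itvr; rewrite bnd_simp lerD2l lerN2.
    by rewrite lef_pV2 ?posrE// ler_nat.
  - near=> k; rewrite /= -setCitvl probability_setC// PF.
    rewrite -!EFinB lee_fin lerD2l lerN2.
    have /Age : (`]-oo, s[%classic : set R) (s - k.+1%:R^-1).
      by rewrite /= in_itv /= ltrBlDr ltrDl invr_gt0 ltr0n.
    by rewrite /A /= in_itv.
apply/eqP; rewrite eq_le; apply/andP; split.
  apply: le_trans Ple; rewrite -Ps; apply: le_measure => //; rewrite inE//.
  exact: mFray.
apply: (le_trans Pge); rewrite Ps; apply: le_measure => //; rewrite inE//.
exact: mFray.
Unshelve. all: by end_near. Qed.

Let FT : measurableTypeR R -> measurableTypeR R := F.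

Let mFT : measurable_fun setT FT.
Proof. exact: mF. Qed.

(** The image of [P] under its distribution function and the uniform law agree on the rays ]y, +oo[.
    These are stable under intersection, generate the Borel sets and exhaust the line, so the two
    measures are equal. *)
Lemma integral_atomless_cdf (f : R -> \bar R) :
  measurable_fun setT f -> (forall y, 0 <= f y)%E ->
  (\int[P]_x f (fine (P `]-oo, x]%classic)) = \int[lebesgue_measure]_(y in `[0%R, 1%R]) f y)%E.
Proof.
move=> mf f0.
have := @ge0_integral_pushforward _ _ _ _ _ _ mFT P setT f measurableT mf (fun y _ => f0 y).
rewrite preimage_setT => <-.
have := integral_uniform (@ltr01 R) mf f0.
rewrite subr0 invr1 mul1e => <-.
apply: eq_measure_integral => A mA _.
have := @measure_unique _ R (measurableTypeR R) (@RGenOInfty.G R)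
  (fun n => `](- n%:R)%R, +oo[%classic) (RGenOInfty.measurableE R)
  _ _ _ (pushforward P FT) (uniform_prob (@ltr01 R)).
apply => //.
- move=> _ _ [x ->] [y ->]; exists (Num.max x y).
  apply/seteqP; split => z /=; rewrite !in_itv/= !andbT gt_max.
    by move=> [-> ->].
  by move=> /andP[].
- by move=> n; exists (- n%:R).
- rewrite -subTset => x _; exists (Num.truncn (- x)).+1 => //=.
  by rewrite in_itv/= andbT ltrNl Num.Theory.truncnS_gt.
- move=> _ [y ->].
  transitivity (1 - P (F @^-1` `]-oo, y]%classic))%E.
    rewrite -probability_setC//; last exact: mFray.
    by rewrite /pushforward; congr (P _); rewrite preimage_setC setCitvl.
  transitivity (lebesgue_measure (`]y, +oo[%classic `&` `[0, 1]%classic : set R)); last first.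
    have := integral_uniform (@ltr01 R) (f := fun x => (\1_(`]y, +oo[%classic) x)%:E).
    rewrite subr0 invr1 mul1e !integral_indic// setIT => -> //.
    exact/measurable_EFinP/measurable_indic.
  (* Outside [0, 1) the ray is trivial: F never exceeds 1, and is never negative. [cdf_ray_le]
     handles the remaining values. *)
  have [y1|y1] := leP 1 y.
    rewrite (_ : F @^-1` _ = setT) ?probability_setT; last first.
      rewrite -subTset => x _ /=; rewrite in_itv/= (le_trans _ y1)//.
      by rewrite -lee_fin -PF probability_le1.
    rewrite subee// (_ : _ `&` _ = set0) ?measure0// -subset0 => x /=.
    rewrite !in_itv/= andbT => -[yx /andP[_ x1]].
    by have := le_lt_trans (le_trans x1 y1) yx; rewrite ltxx.
  have [y0|y0] := ltP y 0.
    rewrite (_ : F @^-1` _ = set0) ?measure0 ?sube0; last first.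
      rewrite -subset0 => x /=; rewrite in_itv/= => /le_lt_trans/(_ y0).
      by rewrite ltNge fine_ge0.
    rewrite setIidr; first by rewrite lebesgue_measure_itv/= lte_fin ltr01 oppr0 adde0.
    by move=> x /=; rewrite !in_itv/= andbT => /andP[+ _]; exact: lt_le_trans.
  rewrite cdf_ray_le ?y0// -EFinB (_ : _ `&` _ = `]y, 1]%classic); last first.
    apply/seteqP; split => x /=; rewrite !in_itv/= andbT.
      by move=> [-> /andP[_ ->]].
    by move=> /andP[yx ->]; rewrite yx (le_trans y0 (ltW yx)).
  by rewrite lebesgue_measure_itv/= lte_fin y1.
- move=> k; rewrite /pushforward -ge0_fin_numE// fin_num_measure//.
  by rewrite -[X in measurable X]setTI; exact: mFT.
Qed.

End atomless_cdf.

(** * Distribution functions of densities on the line *)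

Section density_cdf.
Context (R : realType) (p : R -> R).
Hypotheses (mp : measurable_fun setT p) (p0 : forall x, 0 <= p x).
Hypothesis p1 : (\int[lebesgue_measure]_x (p x)%:E = 1)%E.

Let P : set (measurableTypeR R) -> \bar R :=
  @density_measure _ (measurableTypeR R) R (@lebesgue_measure R) p mp p0.

HB.instance Definition _ := Measure.on P.
HB.instance Definition _ := @Measure_isProbability.Build _ _ R P p1.

Lemma measurable_density_cdfT : measurable_fun setT (density_cdf p).
Proof.
apply: nondecreasing_measurable => // x y xy.
rewrite fine_le ?(fin_num_measure P)//; apply: (@le_measure _ _ _ P); rewrite ?inE//.
exact: subset_itvl.
Qed.

Lemma density_cdf_itv01 x : `[0, 1]%classic (density_cdf p x).
Proof.
rewrite /= in_itv/= fine_ge0 ?(measure_ge0 P)//= -lee_fin fineK.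
  exact: (probability_le1 P).
exact: (fin_num_measure P).
Qed.

Lemma integral_density_cdf (f : R -> \bar R) :
  measurable_fun setT f -> (forall y, 0 <= f y)%E ->
  (\int[lebesgue_measure]_x (f (density_cdf p x) * (p x)%:E) =
   \int[lebesgue_measure]_(y in `[0%R, 1%R]) f y)%E.
Proof.
(* A law with a Lebesgue density has no atoms, since points are Lebesgue null. *)
move=> mf f0; rewrite -(@integral_atomless_cdf _ P)//; last first.
  by move=> x; exact: integral_set1.
rewrite integral_density_measure//.
exact: (measurableT_comp mf measurable_density_cdfT).
Qed.

End density_cdf.

(** * Rosenblatt maps *)

Section Rosenblatt.
Context (R : realType).
Local Notation leb := (@lebesgue_measure R).

(** The measure on R^(n+1) is by construction the image of a product measure under [Rn_cons], so
    Tonelli's theorem applies after transport. *)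
Lemma integral_Rn_cons n (f : Rn R n.+1 -> \bar R) :
  measurable_fun setT f -> (forall x, 0 <= f x)%E ->
  (\int[lebesgue_Rn R n.+1]_x f x =
   \int[leb]_t \int[lebesgue_Rn R n]_y f (Rn_cons (t, y)))%E.
Proof.
move=> mf f0.
transitivity (\int[leb \x lebesgue_Rn R n]_z f (Rn_cons z))%E.
  have := @ge0_integral_pushforward _ _ _ _ R (@Rn_cons R n) (measurable_Rn_cons (n:=n))
    (leb \x lebesgue_Rn R n)%E setT f measurableT mf (fun y _ => f0 y).
  by rewrite preimage_setT => <-.
rewrite fubini_tonelli1// /fubini_F//.
exact: measurableT_comp (measurable_Rn_cons (n:=n)).
Qed.

Lemma measurable_thead n : measurable_fun setT (@thead n (measurableTypeR R)).
Proof. exact: (@measurable_tnth _ (measurableTypeR R) _ ord0). Qed.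

Section parameter.
Context dA (A : measurableType dA).

(** The domain of integration moves with the second variable. Moving it into the integrand as a
    condition gives an integral over the whole line, to which Tonelli's measurability statement
    applies. *)
Lemma measurable_density_cdf (q : A -> R -> R) :
  measurable_fun setT (fun z : A * measurableTypeR R => q z.1 z.2) ->
  (forall a t, 0 <= q a t) ->
  measurable_fun setT (fun z : A * measurableTypeR R => density_cdf (q z.1) z.2).
Proof.
move=> mq q0; apply: measurableT_comp => //.
pose f (w : (A * measurableTypeR R) * measurableTypeR R) : \bar R :=
  if w.2 <= w.1.2 then (q w.1.1 w.2)%:E else 0%E.
rewrite (_ : (fun _ => _) = fubini_F leb f); last first.
  apply/funext => -[a t]; rewrite /fubini_F [LHS]integral_mkcond.
  apply: eq_integral => s _; rewrite patchE /f /=.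
  by rewrite mem_setE in_itv.
apply: measurable_fun_fubini_tonelli_F.
- apply: measurable_fun_ifT => //.
    by apply: measurable_fun_ler => //; apply: measurableT_comp.
  apply/measurable_EFinP.
by apply: (measurable_fun_apply2 mq) => //; apply: measurableT_comp.
- by move=> w; rewrite /f; case: ifP => // _; rewrite lee_fin.
Qed.

Lemma measurable_first_marginal n (p : A -> Rn R n.+1 -> R) :
  measurable_fun setT (fun z : A * Rn R n.+1 => p z.1 z.2) ->
  (forall a x, 0 <= p a x) ->
  measurable_fun setT (fun z : A * measurableTypeR R => first_marginal (p z.1) z.2).
Proof.
move=> mp p0; apply: measurableT_comp => //.
apply: (@measurable_fun_fubini_tonelli_F _ _ _ _ _ (lebesgue_Rn R n)
  (fun w : (A * measurableTypeR R) * Rn R n => (p w.1.1 (Rn_cons (w.1.2, w.2)))%:E)).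
- apply/measurable_EFinP.
  apply: (measurable_fun_apply2 mp); first exact: measurableT_comp.
  apply: (measurableT_comp (measurable_Rn_cons (n:=n))).
  by apply: measurable_fun_pair => //; exact: measurableT_comp.
- by move=> w; rewrite lee_fin.
Qed.

Lemma measurable_conditional n (p : A -> Rn R n.+1 -> R) :
  measurable_fun setT (fun z : A * Rn R n.+1 => p z.1 z.2) ->
  (forall a x, 0 <= p a x) ->
  measurable_fun setT
    (fun w : (A * measurableTypeR R) * Rn R n => conditional (p w.1.1) w.1.2 w.2).
Proof.
move=> mp p0; apply: measurable_funM.
  apply: (measurable_fun_apply2 mp); first exact: measurableT_comp.
  apply: (measurableT_comp (measurable_Rn_cons (n:=n))).
  by apply: measurable_fun_pair => //; exact: measurableT_comp.
apply: (measurableT_comp (@measurable_inv R)).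
have mfst : measurable_fun setT
    (fst : (A * measurableTypeR R) * Rn R n -> A * measurableTypeR R).
  exact: measurable_fst.
exact: (measurableT_comp (measurable_first_marginal mp p0) mfst).
Qed.

End parameter.

(** The parameter is what makes the induction work: the tail of the map belongs to a conditional
    density that depends on the first coordinate, so the inductive step passes from the parameter
    space [A] to its product with the line. *)
Lemma measurable_rosenblatt n dA (A : measurableType dA) (p : A -> Rn R n -> R) :
  measurable_fun setT (fun z : A * Rn R n => p z.1 z.2) ->
  (forall a x, 0 <= p a x) ->
  measurable_fun setT (fun z : A * Rn R n => rosenblatt (p z.1) z.2).
Proof.
elim: n dA A p => [|n IH] dA A p mp p0 /=; first exact: measurable_snd.
apply: (@measurable_cons _ _ _ (measurableTypeR R)).
  have mq := measurable_first_marginal mp p0.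
  have q0 a t : 0 <= first_marginal (p a) t.
    by apply: fine_ge0; apply: integral_ge0 => y _; rewrite lee_fin.
  apply: (measurable_fun_apply2
    (q := fun a : A => density_cdf (first_marginal (p a)) : measurableTypeR R -> R)
    (measurable_density_cdf mq q0)) => //.
  apply: measurableT_comp => //; exact: measurable_thead.
have cp0 (w : A * measurableTypeR R) y : 0 <= conditional (p w.1) w.2 y.
  by rewrite divr_ge0// fine_ge0// integral_ge0// => z _; rewrite lee_fin.
have msnd : measurable_fun setT (snd : A * Rn R n.+1 -> Rn R n.+1).
  exact: measurable_snd.
have mf : measurable_fun setT (fun z : A * Rn R n.+1 => (z.1, thead z.2 : measurableTypeR R)).
  apply: measurable_fun_pair => //.
  exact: (measurableT_comp (@measurable_thead n) msnd).
have mg : measurable_fun setT (fun z : A * Rn R n.+1 => [tuple of behead z.2] : Rn R n).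
  exact: (measurableT_comp (@measurable_behead _ (measurableTypeR R) n) msnd).
pose cp (w : A * measurableTypeR R) := conditional (p w.1) w.2.
exact: (measurable_fun_apply2 (q := fun w => rosenblatt (cp w))
  (IH _ _ cp (measurable_conditional mp p0) cp0) mf mg).
Qed.

Lemma behead_cons n (z : measurableTypeR R * Rn R n) :
  [tuple of behead (Rn_cons z)] = z.2 :> Rn R n.
Proof. exact/val_inj. Qed.

Lemma measurable_rosenblattT n (p : Rn R n -> R) :
  measurable_fun setT p -> (forall x, 0 <= p x) ->
  measurable_fun setT (rosenblatt p).
Proof.
move=> mp p0.
(* A constant family over a dummy parameter space, afterwards evaluated at the parameter 0. *)
have mr : measurable_fun setT (fun z : measurableTypeR R * Rn R n => rosenblatt p z.2).
  apply: (@measurable_rosenblatt n _ (measurableTypeR R) (fun=> p)) => //.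
  exact: (measurableT_comp mp).
have mx : measurable_fun setT (fun x : Rn R n => (0 : measurableTypeR R, x)).
  by apply: measurable_fun_pair.
exact: (measurableT_comp mr mx).
Qed.

Lemma unit_cube_cons n (z : measurableTypeR R * Rn R n) :
  unit_cube (Rn_cons z) <-> `[0, 1]%classic z.1 /\ unit_cube z.2.
Proof.
split=> [h|[h1 h2] i].
  split; first exact: (h ord0).
  by move=> i; have := h (lift ord0 i); rewrite tnthS.
by case: (unliftP ord0 i) => [j ->|->] //; rewrite tnthS; exact: h2.
Qed.

Lemma measurable_unit_cube n : measurable (@unit_cube R n).
Proof. by apply: measurable_box => i; exact: measurable_itv. Qed.

Lemma integral_unit_cube n (f : Rn R n.+1 -> \bar R) :
  measurable_fun setT f -> (forall x, 0 <= f x)%E ->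
  (\int[lebesgue_Rn R n.+1]_(x in @unit_cube R n.+1) f x =
   \int[leb]_(t in `[0%R, 1%R])
     \int[lebesgue_Rn R n]_(y in @unit_cube R n) f (Rn_cons (t, y)))%E.
Proof.
move=> mf f0; rewrite integral_mkcond integral_Rn_cons; last 2 first.
- by apply: (measurable_restrictT f (@measurable_unit_cube n.+1)).1; exact: measurable_funTS.
- by move=> x; rewrite patchE; case: ifP.
rewrite [RHS]integral_mkcond; apply: eq_integral => t _.
rewrite patchE; case: ifPn => [t01|t01].
  rewrite [RHS]integral_mkcond; apply: eq_integral => y _.
  rewrite !patchE; congr (if _ then _ else _); apply/idP/idP; rewrite !inE => h.
    by have [] := (unit_cube_cons (t, y)).1 h.
  by apply/unit_cube_cons; split=> //; rewrite inE in t01.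
apply: integral0_eq => y _; rewrite patchE ifF//; apply/negP; rewrite inE.
by move=> /unit_cube_cons[/= ht _]; rewrite mem_set in t01.
Qed.

Lemma rosenblatt_cons n (p : Rn R n.+1 -> R) t y :
  rosenblatt p (Rn_cons (t, y)) =
  Rn_cons (density_cdf (first_marginal p) t, rosenblatt (conditional p t) y).
Proof. by rewrite /= behead_cons. Qed.

(** For fixed first coordinate t, the induction hypothesis for the conditional density turns the
    inner integral into a function of F_1(t) alone; the one-dimensional transform for the first
    marginal then makes F_1(t) uniform. *)
Lemma integral_rosenblatt n (p : Rn R n -> R) (f : Rn R n -> \bar R) :
  measurable_fun setT p -> (forall x, 0 <= p x) ->
  (\int[lebesgue_Rn R n]_x (p x)%:E = 1)%E ->
  measurable_fun setT f -> (forall x, 0 <= f x)%E ->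
  (\int[lebesgue_Rn R n]_x (f (rosenblatt p x) * (p x)%:E) =
   \int[lebesgue_Rn R n]_(y in @unit_cube R n) f y)%E.
Proof.
elim: n p f => [|n IH] p f mp p0 p1 mf f0.
  have mp' := (@measurable_EFinP _ _ _ setT p).2 mp.
  have mfp : measurable_fun setT (fun x => f (rosenblatt p x) * (p x)%:E)%E.
    exact: emeasurable_funM.
  (* The measure on R^0 is a unit mass at the empty tuple, so normalisation says that [p] equals 1
     there. *)
  move: p1 => /=; rewrite !integral_dirac// ?diracT ?mul1e => [p1||]; last 2 first.
  - exact: measurable_unit_cube.
  - exact: measurable_funTS.
  by rewrite p1 mule1 diracE mem_set ?mul1e// => -[].
pose I t := (\int[lebesgue_Rn R n]_y (p (Rn_cons (t, y)))%:E)%E.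
have mpc : measurable_fun setT (fun z : measurableTypeR R * Rn R n => p (Rn_cons z)).
  exact: (measurableT_comp mp (@measurable_Rn_cons R n)).
have mI : measurable_fun setT I.
  apply: (@measurable_fun_fubini_tonelli_F _ _ _ _ _ (lebesgue_Rn R n)
    (fun z => (p (Rn_cons z))%:E)).
    exact/measurable_EFinP.
  by move=> z; rewrite lee_fin.
have I0 t : (0 <= I t)%E by apply: integral_ge0 => y _; rewrite lee_fin.
have I1 : (\int[leb]_t I t = 1)%E.
  by rewrite -p1 integral_Rn_cons//; exact/measurable_EFinP.
(* The real-valued marginal [q] differs from the slice mass [I] only where [I] is infinite, and that
   set is null because [I] has integral 1. *)
have Ifin : {ae leb, forall t, I t \is a fin_num}.
  have : leb.-integrable setT I.
    apply/integrableP; split=> //.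
    under eq_integral do rewrite gee0_abs//.
    by rewrite I1 ltry.
  move=> /integrable_ae => /(_ measurableT).
  by apply: filterS => t; apply.
pose q := first_marginal p.
have q0 t : 0 <= q t by exact: fine_ge0 (I0 t).
have mq : measurable_fun setT q by exact: (measurableT_comp (fine_measurable measurableT) mI).
have qI : ae_eq leb setT I (EFin \o q).
  by apply: filterS Ifin => t It _; rewrite /= /q /first_marginal /Rintegral fineK.
have q1 : (\int[leb]_t (q t)%:E = 1)%E.
  rewrite -I1; apply: ge0_ae_eq_integral => //.
  - exact/measurable_EFinP.
  - by move=> t _; rewrite lee_fin.
  - by apply: filterS qI => t h /h.
have mfc s : measurable_fun setT (fun y : Rn R n => f (Rn_cons (s, y))).
  have mx : measurable_fun setT (fun x : Rn R n => (s : measurableTypeR R, x)).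
    by apply: measurable_fun_pair.
  exact: (measurableT_comp (measurableT_comp mf (@measurable_Rn_cons R n)) mx).
rewrite integral_unit_cube//.
pose G s := (\int[lebesgue_Rn R n]_(y in @unit_cube R n) f (Rn_cons (s, y)))%E.
have mG : measurable_fun setT G.
  rewrite (_ : G = fun s => \int[lebesgue_Rn R n]_y
     (if y \in @unit_cube R n then f (Rn_cons (s, y)) else 0))%E; last first.
    by apply/funext => s; rewrite /G integral_mkcond.
  apply: (@measurable_fun_fubini_tonelli_F _ _ _ _ _ (lebesgue_Rn R n)
    (fun z => if z.2 \in @unit_cube R n then f (Rn_cons z) else 0%E)).
    apply: measurable_fun_ifT => //; last exact: (measurableT_comp mf (@measurable_Rn_cons R n)).
    apply: (measurable_fun_bool true) => //.
    rewrite setTI (_ : _ @^-1` _ = snd @^-1` @unit_cube R n).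
      rewrite -[X in measurable X]setTI; apply: measurable_snd => //.
      exact: measurable_unit_cube.
    by apply/seteqP; split => z /=; [move/set_mem|move/mem_set].
  by move=> z; case: ifP.
have G0 s : (0 <= G s)%E by apply: integral_ge0.
have mh : measurable_fun setT (fun x => f (rosenblatt p x) * (p x)%:E)%E.
  apply: emeasurable_funM; last exact/measurable_EFinP.
  by apply: (measurableT_comp mf); exact: measurable_rosenblattT.
rewrite -(integral_density_cdf mq q0 q1 mG G0) integral_Rn_cons//; last first.
- by move=> x; rewrite mule_ge0// lee_fin.
apply: ge0_ae_eq_integral => //.
- apply: (@measurable_fun_fubini_tonelli_F _ _ _ _ _ (lebesgue_Rn R n)
    (fun z => f (rosenblatt p (Rn_cons z)) * (p (Rn_cons z))%:E)%E).
    exact: (measurableT_comp mh (@measurable_Rn_cons R n)).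
  by move=> z; rewrite mule_ge0// lee_fin.
- apply: emeasurable_funM; last exact/measurable_EFinP.
  by apply: (measurableT_comp mG); exact: measurable_density_cdfT.
- move=> t _; apply: integral_ge0 => y _; rewrite mule_ge0// lee_fin//.
- move=> t _; rewrite mule_ge0// lee_fin//.
apply: filterS qI => t /(_ Logic.I) It _.
have mx : measurable_fun setT (fun y : Rn R n => (t : measurableTypeR R, y)).
  exact: measurable_fun_pair.
have mpt : measurable_fun setT (fun y => p (Rn_cons (t, y))).
  exact: (measurableT_comp mpc mx).
have mht : measurable_fun setT
    (fun y => f (rosenblatt p (Rn_cons (t, y))) * (p (Rn_cons (t, y)))%:E)%E.
  exact: (measurableT_comp (measurableT_comp mh (@measurable_Rn_cons R n)) mx).
(* A slice of mass 0: the conditional density is only a default value here, but [p] vanishes almost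
   everywhere on the slice, so both sides are 0. *)
have [qt0|qt0] := eqVneq (q t) 0.
  rewrite qt0 mule0.
  transitivity (\int[lebesgue_Rn R n]_y (cst 0 y : \bar R))%E; last exact: integral0.
  apply: ae_eq_integral => //.
  have : ae_eq (lebesgue_Rn R n) setT (fun y => (p (Rn_cons (t, y)))%:E) (cst 0%E).
    apply/ae_eq_integral_abs => //; first exact/measurable_EFinP.
    rewrite -[RHS](_ : I t = 0)%E; last by rewrite It /= qt0.
    by apply: eq_integral => y _; rewrite gee0_abs// lee_fin.
  by apply: filterS => y py _; rewrite py// mule0.
under eq_integral do rewrite rosenblatt_cons.
rewrite -/q; set s := density_cdf q t.
have qt_gt0 : 0 < q t by rewrite lt_neqAle eq_sym qt0 q0.
have pE y : p (Rn_cons (t, y)) = q t * conditional p t y.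
  by rewrite /conditional -/q mulrCA divff// mulr1.
have mc : measurable_fun setT (conditional p t) by exact: measurable_funM.
have c0 y : 0 <= conditional p t y by rewrite divr_ge0// ?q0.
have c1 : (\int[lebesgue_Rn R n]_y (conditional p t y)%:E = 1)%E.
  transitivity ((q t)^-1%:E * I t)%E; last by rewrite It /= -EFinM mulVf.
  rewrite -ge0_integralZl//; last 3 first.
  - exact/measurable_EFinP.
  - by move=> y _; rewrite lee_fin.
  - by rewrite lee_fin invr_ge0.
  by apply: eq_integral => y _; rewrite -EFinM mulrC.
have := IH (conditional p t) (fun y => f (Rn_cons (s, y))) mc c0 c1 (mfc s) (fun y => f0 _).
rewrite -/(G s) => <-.
rewrite muleC -ge0_integralZl//; last 3 first.
- apply: emeasurable_funM; last exact/measurable_EFinP.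
  apply: (measurableT_comp (mfc s)); exact: measurable_rosenblattT.
- by move=> y _; rewrite mule_ge0// lee_fin.
- by rewrite lee_fin.
by apply: eq_integral => y _; rewrite pE EFinM muleCA.
Qed.
End Rosenblatt.

(** * Product densities and their Rosenblatt maps *)

Section product_densities.
Context (R : realType).
Local Notation leb := (@lebesgue_measure R).

Lemma measurable_prod_fun n (E : 'I_n -> set R) (h : 'I_n -> R -> R) :
  (forall i, measurable (E i)) -> (forall i, measurable_fun (E i) (h i)) ->
  measurable_fun (box E) (prod_fun h).
Proof.
move=> mE mh; apply: measurable_prod => i _.
apply: (@measurable_comp _ _ _ _ _ _ (E i) (h i) (box E) (fun x : Rn R n => tnth x i)) => //.
- by move=> _ [x Ex <-]; exact: Ex.
- by apply: measurable_funTS; exact: measurable_tnth.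
Qed.

Lemma measurable_patch_prod_fun n (E : 'I_n -> set R) (h : 'I_n -> R -> R) :
  (forall i, measurable (E i)) -> (forall i, measurable_fun (E i) (h i)) ->
  measurable_fun setT (prod_fun h \_ (box E)).
Proof.
move=> mE mh; apply: (measurable_restrictT _ (measurable_box mE)).1.
exact: measurable_prod_fun.
Qed.

Lemma prod_fun_gt0 n (E : 'I_n -> set R) (h : 'I_n -> R -> R) x :
  (forall i t, E i t -> 0 < h i t) -> box E x -> 0 < prod_fun h x.
Proof. by move=> h0 Ex; apply: prodr_gt0 => i _; exact/h0/Ex. Qed.

Lemma patch_prod_fun_ge0 n (E : 'I_n -> set R) (h : 'I_n -> R -> R) x :
  (forall i t, E i t -> 0 < h i t) -> 0 <= (prod_fun h \_ (box E)) x.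
Proof.
move=> h0; rewrite patchE; case: ifPn => // /set_mem Ex.
exact/ltW/(prod_fun_gt0 h0).
Qed.

Lemma patch_prod_fun_cons n (E : 'I_n.+1 -> set R) (h : 'I_n.+1 -> R -> R) t y :
  (prod_fun h \_ (box E)) (Rn_cons (t, y)) =
  (h ord0 \_ (E ord0)) t *
  (prod_fun (fun i => h (lift ord0 i)) \_ (box (fun i => E (lift ord0 i)))) y.
Proof.
have boxE : box E (Rn_cons (t, y)) <-> E ord0 t /\ box (fun i => E (lift ord0 i)) y.
  split=> [Ex|[E0 Ey] i].
    split; first exact: (Ex ord0).
    by move=> i; have := Ex (lift ord0 i); rewrite tnthS.
  by case: (unliftP ord0 i) => [j ->|->] //; rewrite tnthS; exact: Ey.
rewrite !patchE; case: ifPn => [/set_mem/boxE[Et Ey]|Ex].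
  rewrite !mem_set// /prod_fun big_ord_recl; congr (_ * _).
  by apply: eq_bigr => i _; rewrite tnthS.
case: ifPn => [/set_mem Et|_]; last by rewrite mul0r.
case: ifPn => [/set_mem Ey|_]; last by rewrite mulr0.
by case/negP: Ex; apply/mem_set/boxE.
Qed.

Lemma product_density_lift n (E : 'I_n.+1 -> set R) (h : 'I_n.+1 -> R -> R) :
  product_probability_density E h ->
  product_probability_density (fun i => E (lift ord0 i)) (fun i => h (lift ord0 i)).
Proof.
by move=> [mh h0 h1]; split=> [i|i t|i]; [exact: mh|exact: h0|exact: h1].
Qed.

Lemma integral_product_density n (E : 'I_n -> set R) (h : 'I_n -> R -> R) :
  (forall i, measurable (E i)) -> product_probability_density E h ->
  (\int[lebesgue_Rn R n]_x ((prod_fun h \_ (box E)) x)%:E = 1)%E.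
Proof.
elim: n E h => [|n IH] E h mE hE; have [mh h0 h1] := hE.
  rewrite /= integral_dirac//; last by apply/measurable_EFinP; exact: measurable_patch_prod_fun.
  rewrite diracT mul1e patchE mem_set; first by rewrite /prod_fun big_ord0.
  by move=> [].
rewrite integral_Rn_cons; last 2 first.
- by apply/measurable_EFinP; exact: measurable_patch_prod_fun.
- by move=> x; rewrite lee_fin patch_prod_fun_ge0.
transitivity (\int[leb]_t ((h ord0 \_ (E ord0)) t)%:E)%E.
  apply: eq_integral => t _.
  under eq_integral do rewrite patch_prod_fun_cons EFinM.
  rewrite ge0_integralZl//; last 3 first.
  - apply/measurable_EFinP.
    exact: (measurable_patch_prod_fun (fun i => mE _) (fun i => mh _)).
  - by move=> y _; rewrite lee_fin; exact: (patch_prod_fun_ge0 _ (fun i => h0 _)).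
  - by rewrite lee_fin patchE; case: ifPn => // /set_mem /h0/ltW.
  by rewrite (IH _ _ (fun i => mE _) (product_density_lift hE)) mule1.
rewrite -(h1 ord0) [RHS]integral_mkcond; apply: eq_integral => t _.
by rewrite !patchE; case: ifP.
Qed.

Lemma first_marginal_product n (E : 'I_n.+1 -> set R) (h : 'I_n.+1 -> R -> R) :
  (forall i, measurable (E i)) -> product_probability_density E h ->
  first_marginal (prod_fun h \_ (box E)) = h ord0 \_ (E ord0).
Proof.
move=> mE hE; have [mh h0 h1] := hE; apply/funext => t; rewrite /first_marginal /Rintegral.
under eq_integral do rewrite patch_prod_fun_cons EFinM.
rewrite ge0_integralZl//; last 3 first.
- apply/measurable_EFinP.
  exact: (measurable_patch_prod_fun (fun i => mE _) (fun i => mh _)).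
- by move=> y _; rewrite lee_fin; exact: (patch_prod_fun_ge0 _ (fun i => h0 _)).
- by rewrite lee_fin patchE; case: ifPn => // /set_mem /h0/ltW.
by rewrite (integral_product_density (fun i => mE _) (product_density_lift hE)) mule1.
Qed.

(** Coordinates are independent, so conditioning on the first one leaves the product of the other
    factors. Membership in the box makes the first marginal positive at [x], which justifies the
    division. *)
Lemma rosenblatt_product n (E : 'I_n -> set R) (h : 'I_n -> R -> R) x :
  (forall i, measurable (E i)) -> product_probability_density E h ->
  box E x -> rosenblatt (prod_fun h \_ (box E)) x = marginal_cdfs E h x.
Proof.
elim: n E h x => [|n IH] E h x mE hE Ex /=.
  by apply/val_inj; rewrite [x]tuple0 [marginal_cdfs _ _ _]tuple0.
have [mh h0 h1] := hE.
have Ex0 : E ord0 (thead x) := Ex ord0.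
have hx0 : (h ord0 \_ (E ord0)) (thead x) != 0.
  by rewrite patchE mem_set// gt_eqF// h0.
rewrite first_marginal_product//.
have -> : conditional (prod_fun h \_ (box E)) (thead x) =
    prod_fun (fun i => h (lift ord0 i)) \_ (box (fun i => E (lift ord0 i))).
  apply/funext => y; rewrite /conditional first_marginal_product//.
  by rewrite patch_prod_fun_cons mulrC mulKf.
rewrite (IH _ _ _ (fun i => mE _) (product_density_lift hE))//; last first.
  move=> i; have := Ex (lift ord0 i).
  by rewrite {1}(tuple_eta x) tnthS.
apply: eq_from_tnth => i; rewrite tnth_mktuple.
case: (unliftP ord0 i) => [j ->|->] //.
by rewrite tnthS tnth_mktuple [in RHS](tuple_eta x) tnthS.
Qed.

End product_densities.

(** * Push-forward by the reference map and by an inverse Rosenblatt transport *)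

Section push_forward.
Context (R : realType) (n : nat).
Local Notation mu := (lebesgue_Rn R n).
Local Notation cube := (@unit_cube R n).

Section marginals.
Variables (E : 'I_n -> set R) (h : 'I_n -> R -> R).
Hypotheses (mE : forall i, measurable (E i)) (hE : product_probability_density E h).

Let mp i : measurable_fun setT (h i \_ (E i)).
Proof.
by have [mh _ _] := hE; apply: (measurable_restrictT _ (mE i)).1; exact: mh.
Qed.

Let p0 i x : 0 <= (h i \_ (E i)) x.
Proof.
by have [_ h0 _] := hE; rewrite patchE; case: ifPn => // /set_mem /h0/ltW.
Qed.

Let p1 i : (\int[lebesgue_measure]_x ((h i \_ (E i)) x)%:E = 1)%E.
Proof.
have [_ _ h1] := hE; rewrite -(h1 i) [RHS]integral_mkcond.
by apply: eq_integral => x _; rewrite !patchE; case: ifP.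
Qed.

Lemma measurable_marginal_cdfs : measurable_fun setT (marginal_cdfs E h).
Proof.
apply/(measurable_fun_tnthP (T2 := measurableTypeR R)) => i.
rewrite (_ : _ \o _ = fun u : Rn R n => density_cdf (h i \_ (E i)) (tnth u i)); last first.
  by apply/funext => u /=; rewrite tnth_mktuple.
exact: (measurableT_comp (measurable_density_cdfT (@mp i) (@p0 i) (p1 i))
  (@measurable_tnth _ (measurableTypeR R) n i)).
Qed.

Lemma marginal_cdfs_cube u : cube (marginal_cdfs E h u).
Proof.
move=> i; rewrite tnth_mktuple.
exact: (density_cdf_itv01 (@mp i) (@p0 i) (p1 i)).
Qed.

(** This is the statement that R pushes mu to the uniform measure. As [f] is controlled on the cube
    only, [integral_rosenblatt] is applied to its extension by 0. *)
Lemma integral_marginal_cdfs (f : Rn R n -> \bar R) :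
  measurable_fun cube f -> (forall y, cube y -> 0 <= f y)%E ->
  (\int[mu]_(u in box E) (f (marginal_cdfs E h u) * (prod_fun h u)%:E) =
   \int[mu]_(y in cube) f y)%E.
Proof.
move=> mf f0; have [mh h0 _] := hE.
have mF : measurable_fun setT (f \_ cube).
  by apply: (measurable_restrictT _ (@measurable_unit_cube R n)).1.
have F0 y : (0 <= (f \_ cube) y)%E.
  by rewrite patchE; case: ifPn => // /set_mem; exact: f0.
rewrite [RHS]integralEpatch; last exact: measurable_unit_cube.
rewrite -(integral_rosenblatt (measurable_patch_prod_fun mE mh)
  (fun x => patch_prod_fun_ge0 x h0) (integral_product_density mE hE) mF F0).
rewrite integral_mkcond; apply: eq_integral => u _; rewrite [LHS]patchE.
case: ifPn => uE; last first.
  rewrite (_ : (prod_fun h \_ (box E)) u = 0) ?mule0//.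
  by rewrite patchE (negbTE uE).
rewrite rosenblatt_product//; last exact/set_mem.
by rewrite !patchE uE mem_set//; exact: marginal_cdfs_cube.
Qed.

End marginals.

(** The forward identity is tested with [f \o T] on the cube; almost everywhere on [D], applying [T]
    after the Rosenblatt map gives back the point. *)
Lemma integral_inverse_rosenblatt (D : set (Rn R n)) (p : Rn R n -> R)
    (T : Rn R n -> Rn R n) (f : Rn R n -> \bar R) :
  measurable D -> measurable_fun D p -> (forall x, D x -> 0 <= p x) ->
  (\int[mu]_(x in D) (p x)%:E = 1)%E -> inverse_rosenblatt D p T ->
  measurable_fun D f -> (forall x, D x -> 0 <= f x)%E ->
  (\int[mu]_(y in cube) f (T y) = \int[mu]_(x in D) (f x * (p x)%:E))%E.
Proof.
move=> mD mp p0 p1 [mT TD TK _] mf f0.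
have mcube := @measurable_unit_cube R n.
have mq : measurable_fun setT (p \_ D) by apply: (measurable_restrictT _ mD).1.
have q0 x : 0 <= (p \_ D) x by rewrite patchE; case: ifPn => // /set_mem; exact: p0.
have q1 : (\int[mu]_x ((p \_ D) x)%:E = 1)%E.
  rewrite -p1 [RHS]integral_mkcond; apply: eq_integral => x _.
  by rewrite !patchE; case: ifP.
have mfT : measurable_fun cube (f \o T).
  exact: (measurable_comp mD TD mf mT).
pose F := (f \o T) \_ cube.
have mF : measurable_fun setT F by apply: (measurable_restrictT _ mcube).1.
have F0 y : (0 <= F y)%E.
  by rewrite /F patchE; case: ifPn => // /set_mem yc; apply: f0; apply: TD; exists y.
have mros := measurable_rosenblattT mq q0.
(* Points sent outside the cube, where the test function was cut off, carry no mass: the forward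
   identity for the indicator of the complement of the cube has right-hand side 0. *)
have out : {ae mu, forall x, D x -> ~ cube (rosenblatt (p \_ D) x) -> p x = 0}.
  pose G := (\1_(~` cube) : Rn R n -> R).
  have mG : measurable_fun setT (EFin \o G).
    by apply/measurable_EFinP/measurable_indic; exact: measurableC.
  have G0 y : (0 <= (EFin \o G) y)%E by rewrite lee_fin.
  have := integral_rosenblatt mq q0 q1 mG G0.
  rewrite [RHS]integral0_eq; last first.
    by move=> y cy; rewrite /G /= indicE memNset//= => /(_ cy).
  move=> int0.
  have mGp : measurable_fun setT
      (fun x => (EFin \o G) (rosenblatt (p \_ D) x) * ((p \_ D) x)%:E)%E.
    apply: emeasurable_funM; last exact/measurable_EFinP.
    exact: (measurableT_comp mG).
  have : (\int[mu]_x `|(EFin \o G) (rosenblatt (p \_ D) x) * ((p \_ D) x)%:E| = 0)%E.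
    rewrite -[RHS]int0; apply: eq_integral => x _.
    by rewrite gee0_abs// mule_ge0// lee_fin.
  move=> /(ae_eq_integral_abs mu measurableT mGp).
  apply: filterS => x /(_ Logic.I) Gp Dx ncx; move: Gp.
  by rewrite /= /G indicE mem_set// mul1e patchE mem_set// => -[].
transitivity (\int[mu]_(y in cube) F y)%E.
  rewrite integral_mkcond [RHS]integral_mkcond; apply: eq_integral => y _.
  by rewrite /F !patchE; case: ifP => // ->.
rewrite -(integral_rosenblatt mq q0 q1 mF F0).
transitivity (\int[mu]_(x in D) (F (rosenblatt (p \_ D) x) * (p x)%:E))%E.
  rewrite [RHS]integral_mkcond; apply: eq_integral => x _.
  by rewrite [in LHS]patchE [RHS]patchE; case: ifP => //; rewrite mule0.
have mpE : measurable_fun D (EFin \o p) by exact/measurable_EFinP.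
apply: ge0_ae_eq_integral => //.
- apply: emeasurable_funM => //; apply: measurable_funTS.
  exact: (measurableT_comp mF).
- exact: emeasurable_funM.
- by move=> x Dx; rewrite mule_ge0// lee_fin p0.
- by move=> x Dx; rewrite mule_ge0 ?f0// lee_fin p0.
apply: filterS2 TK out => x Tx ox Dx; rewrite /F patchE.
case: ifPn => [_|/negP nc]; first by rewrite /= Tx.
by rewrite ox ?mule0// => c; apply: nc; exact/mem_set.
Qed.

End push_forward.

(** * Weighted square norms and layers *)

Section weighted_L2.
Context d (T : measurableType d) (R : realType) (mu : {measure set T -> \bar R}).
Variables (D : set T) (w : T -> R).
Hypotheses (mD : measurable D) (mw : measurable_fun D w).

(** A positive weight of zero total mass would force [D] to be null, and then every integral over
    [D] would be 0. A second function of positive integral thus certifies that the weight has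
    positive mass. *)
Lemma integral_gt0_of_gt0 (f : T -> \bar R) :
  (forall x, D x -> 0 < w x) -> measurable_fun D f ->
  (0 < \int[mu]_(x in D) f x)%E -> (0 < \int[mu]_(x in D) (w x)%:E)%E.
Proof.
move=> w0 mf f_gt0; rewrite lt0e integral_ge0 ?andbT; last first.
  by move=> x Dx; rewrite lee_fin ltW// w0.
apply/eqP => wI0; move: f_gt0; suff -> : (\int[mu]_(x in D) f x = 0)%E by rewrite ltxx.
have mwE : measurable_fun D (EFin \o w) by exact/measurable_EFinP.
have : (\int[mu]_(x in D) `|(w x)%:E| = 0)%E.
  rewrite -[RHS]wI0; apply: eq_integral => x /set_mem Dx.
  by rewrite gee0_abs// lee_fin ltW// w0.
move=> /(ae_eq_integral_abs mu mD mwE) w_eq0.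
transitivity (\int[mu]_(x in D) (cst 0 x : \bar R))%E; last exact: integral0.
apply: ae_eq_integral => //; apply: filterS w_eq0 => x wx Dx.
by have := w0 x Dx; move: (wx Dx) => -[->]; rewrite ltxx.
Qed.

Hypothesis w0 : forall x, D x -> 0 <= w x.

(* Young's inequality [(f + g)^2 <= (1 + b / a) f^2 + (1 + a / b) g^2] gives the
   bound when a and b are positive *)
Lemma minkowski_sqr (f g : T -> R) (a b : R) :
  measurable_fun D f -> measurable_fun D g -> 0 <= a -> 0 <= b ->
  (\int[mu]_(x in D) (f x ^+ 2 * w x)%:E <= (a ^+ 2)%:E)%E ->
  (\int[mu]_(x in D) (g x ^+ 2 * w x)%:E <= (b ^+ 2)%:E)%E ->
  (\int[mu]_(x in D) ((f x + g x) ^+ 2 * w x)%:E <= ((a + b) ^+ 2)%:E)%E.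
Proof.
move=> mf mg a0 b0 fa gb.
have msqr (h : T -> R) : measurable_fun D h ->
    measurable_fun D (fun x => (h x ^+ 2 * w x)%:E).
  move=> mh; apply/measurable_EFinP; apply: measurable_funM => //.
  exact: measurable_funX.
have sqr0 (h : T -> R) x : D x -> (0 <= (h x ^+ 2 * w x)%:E)%E.
  by move=> Dx; rewrite lee_fin mulr_ge0 ?sqr_ge0 ?w0.
set I := (\int[mu]_(x in D) _)%E.
have I0 : (0 <= I)%E by apply: integral_ge0 => x Dx; exact: (sqr0 (f \+ g)).
(* The shift by [e] makes both numbers positive, so that they can appear as denominators; [e] tends
   to 0 at the end. *)
have bound e : 0 < e -> (I <= ((a + e + (b + e)) ^+ 2)%:E)%E.
  move=> e0; set a' := a + e; set b' := b + e.
  have a'0 : 0 < a' by rewrite ltr_wpDl.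
  have b'0 : 0 < b' by rewrite ltr_wpDl.
  apply: (@le_trans _ _ (\int[mu]_(x in D)
    ((1 + b' / a')%:E * (f x ^+ 2 * w x)%:E + (1 + a' / b')%:E * (g x ^+ 2 * w x)%:E))%E).
    apply: ge0_le_integral => //.
    - by move=> x Dx; exact: (sqr0 (f \+ g)).
    - by apply: (msqr (f \+ g)); exact: measurable_funD.
    - by apply: emeasurable_funD; apply: measurable_funeM; exact: msqr.
    move=> x Dx; rewrite -!EFinM -EFinD lee_fin !mulrA -mulrDl ler_wpM2r ?w0//.
    rewrite -subr_ge0 (_ : _ - _ = (b' * f x - a' * g x) ^+ 2 / (a' * b')).
      by rewrite divr_ge0 ?sqr_ge0// mulr_ge0// ltW.
    by field; rewrite !gt_eqF.
  rewrite ge0_integralD//; last 4 first.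
  - by move=> x Dx; rewrite mule_ge0 ?sqr0// lee_fin addr_ge0// divr_ge0// ltW//.
  - by apply: measurable_funeM; exact: msqr.
  - by move=> x Dx; rewrite mule_ge0 ?sqr0// lee_fin addr_ge0// divr_ge0// ltW//.
  - by apply: measurable_funeM; exact: msqr.
  rewrite !ge0_integralZl//; try exact: msqr; try exact: sqr0;
    try by rewrite lee_fin addr_ge0// divr_ge0// ltW//.
  apply: (@le_trans _ _ ((1 + b' / a')%:E * (a' ^+ 2)%:E + (1 + a' / b')%:E * (b' ^+ 2)%:E)%E).
    apply: leeD; apply: lee_wpmul2l; rewrite ?lee_fin ?addr_ge0 ?divr_ge0 ?(ltW a'0) ?(ltW b'0)//.
      by rewrite (le_trans fa)// lee_fin ler_sqr ?nnegrE ?(ltW a'0)// lerDl ltW.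
    by rewrite (le_trans gb)// lee_fin ler_sqr ?nnegrE ?(ltW b'0)// lerDl ltW.
  rewrite -!EFinM -EFinD lee_fin le_eqVlt; apply/orP; left; apply/eqP.
  by field; rewrite !gt_eqF.
have Ifin : I \is a fin_num.
  by rewrite ge0_fin_numE// (le_lt_trans (bound 1 ltr01))// ltry.
rewrite -(fineK Ifin) lee_fin -[leLHS]sqr_sqrtr ?fine_ge0// ler_sqr ?nnegrE ?sqrtr_ge0 ?addr_ge0//.
apply/ler_addgt0Pr => e e0.
(* Both numbers are shifted, so half of the allowance goes to each. *)
have e20 : 0 < e / 2 by rewrite divr_gt0.
have := bound _ e20; rewrite -(fineK Ifin) lee_fin => /ler_wsqrtr/le_trans; apply.
rewrite sqrtr_sqr ger0_norm; last by rewrite !addr_ge0// ltW.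
by rewrite addrACA -splitr.
Qed.

End weighted_L2.

(** * Normalisation of a single layer *)

Section layers.
Context (R : realType) (d : nat).
Local Notation mu := (lebesgue_Rn R d).
Variables (D : 'I_d -> set R) (w : 'I_d -> R -> R) (c : R) (h : Rn R d -> R).
Hypotheses (hw : product_weight D w) (mh : measurable_fun (box D) h) (c_gt0 : 0 < c).

Let mD : measurable (box D).
Proof. by have [mE _ _ _] := hw; exact: measurable_box. Qed.

Lemma measurable_weight : measurable_fun (box D) (prod_fun w).
Proof. by have [mE mw _ _] := hw; exact: measurable_prod_fun. Qed.

Lemma weight_gt0 x : box D x -> 0 < prod_fun w x.
Proof. by have [_ _ w0 _] := hw; exact: prod_fun_gt0. Qed.

Let mwE : measurable_fun (box D) (fun x => (prod_fun w x)%:E).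
Proof. by apply/measurable_EFinP; exact: measurable_weight. Qed.

Let mh2 : measurable_fun (box D) (fun x => (h x ^+ 2 * prod_fun w x)%:E).
Proof.
apply/measurable_EFinP; apply: measurable_funM measurable_weight.
exact: measurable_funX.
Qed.

Lemma massE : (mass (box D) (prod_fun w))%:E =
  (\int[mu]_(x in box D) (prod_fun w x)%:E)%E.
Proof.
have [_ _ _ woo] := hw; rewrite /mass /Rintegral fineK// ge0_fin_numE//.
by apply: integral_ge0 => x Dx; rewrite lee_fin ltW// weight_gt0.
Qed.

Hypothesis h2_lty : (\int[mu]_(x in box D) (h x ^+ 2 * prod_fun w x)%:E < +oo)%E.

(** [layer_mass] uses real-valued integrals, which return 0 for an infinite value; [h2_lty] and the
    finite weight exclude this. *)
Lemma layer_massE : (layer_mass D w c h)%:E =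
  (\int[mu]_(x in box D) ((c + h x ^+ 2) * prod_fun w x)%:E)%E.
Proof.
have w0 x : box D x -> (0 <= (prod_fun w x)%:E)%E.
  by move=> Dx; rewrite lee_fin ltW// weight_gt0.
have h20 x : box D x -> (0 <= (h x ^+ 2 * prod_fun w x)%:E)%E.
  by move=> Dx; rewrite lee_fin mulr_ge0 ?sqr_ge0// -lee_fin w0.
under eq_integral do rewrite mulrDl EFinD EFinM.
rewrite ge0_integralD//; last 2 first.
- by move=> x Dx; rewrite mule_ge0 ?w0// lee_fin ltW.
- exact: measurable_funeM.
rewrite ge0_integralZl//; last by rewrite lee_fin ltW.
rewrite -massE /layer_mass EFinD EFinM; congr (_ + _)%E.
by rewrite /Rintegral fineK// ge0_fin_numE// integral_ge0.
Qed.

Hypothesis w_gt0 : (0 < \int[mu]_(x in box D) (prod_fun w x)%:E)%E.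

Lemma layer_mass_gt0 : 0 < layer_mass D w c h.
Proof.
rewrite ltr_pwDl// ?mulr_gt0//; first by rewrite -lte_fin massE.
rewrite fine_ge0// integral_ge0// => x Dx.
by rewrite lee_fin mulr_ge0 ?sqr_ge0// ltW// weight_gt0.
Qed.

Lemma measurable_layer_density : measurable_fun (box D) (layer_density D w c h).
Proof.
apply: measurable_funM => //; apply: measurable_funM measurable_weight.
by apply: measurable_funD => //; exact: measurable_funX.
Qed.

Lemma layer_density_ge0 x : box D x -> 0 <= layer_density D w c h x.
Proof.
move=> Dx; rewrite mulr_ge0 ?invr_ge0 ?(ltW layer_mass_gt0)//.
by rewrite mulr_ge0 ?(ltW (weight_gt0 Dx))// addr_ge0 ?sqr_ge0// ltW.
Qed.

Lemma integral_layer_density :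
  (\int[mu]_(x in box D) (layer_density D w c h x)%:E = 1)%E.
Proof.
under eq_integral do rewrite EFinM.
rewrite ge0_integralZl//; last 3 first.
- apply/measurable_EFinP; apply: measurable_funM measurable_weight.
  by apply: measurable_funD => //; exact: measurable_funX.
- move=> x Dx; rewrite lee_fin mulr_ge0 ?(ltW (weight_gt0 Dx))//.
  by rewrite addr_ge0 ?sqr_ge0// ltW.
- by rewrite lee_fin invr_ge0 (ltW layer_mass_gt0).
by rewrite -layer_massE -EFinM mulVf// gt_eqF// layer_mass_gt0.
Qed.

End layers.

(** * The composed map and the density that it produces *)

Section composition.
Context (R : realType) (d k : nat).
Local Notation mu := (lebesgue_Rn R d).
Variables (X U : 'I_d -> set R) (lam om fU : 'I_d -> R -> R).
Variables (g : nat -> Rn R d -> R) (gam : nat -> R) (T S : nat -> Rn R d -> Rn R d).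
Hypotheses (lam_weight : product_weight X lam) (om_weight : product_weight U om).
Hypothesis fU_density : product_probability_density U fU.
Hypothesis layer0 : dirt_layer X lam (gam 0%N) (g 0%N) (T 0%N).
Hypothesis layers : forall j, (1 <= j <= k)%N -> dirt_layer U om (gam j) (g j) (T j).
Hypothesis S_inverse : forall j, (j < k)%N ->
  ae_inverse (box U) (box X) (dirt_map U fU T j) (S j).

Let mX : measurable (box X).
Proof. by have [mE _ _ _] := lam_weight; exact: measurable_box. Qed.

Let mUi i : measurable (U i).
Proof. by have [mE _ _ _] := om_weight. Qed.

Let mU : measurable (box U).
Proof. exact: measurable_box. Qed.

Lemma measurable_fU : measurable_fun (box U) (prod_fun fU).
Proof. by have [mh _ _] := fU_density; exact: measurable_prod_fun. Qed.

Lemma fU_gt0 x : box U x -> 0 < prod_fun fU x.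
Proof. by have [_ f0 _] := fU_density; exact: prod_fun_gt0. Qed.

Lemma integral_fU : (\int[mu]_(u in box U) (prod_fun fU u)%:E = 1)%E.
Proof.
rewrite -(integral_product_density mUi fU_density) integral_mkcond.
by apply: eq_integral => u _; rewrite !patchE; case: ifP.
Qed.

Lemma measurable_layer_step j (D : 'I_d -> set R) (w : 'I_d -> R -> R) c h :
  dirt_layer D w c h (T j) ->
  measurable_fun (box U) (T j \o marginal_cdfs U fU) /\
  (T j \o marginal_cdfs U fU) @` box U `<=` box D.
Proof.
move=> [_ _ _ [mT TD _ _]]; split.
  apply: (@measurable_comp _ _ _ _ _ _ (@unit_cube R d)) => //.
  - exact: measurable_unit_cube.
  - by move=> _ [u _ <-]; exact: (marginal_cdfs_cube mUi fU_density).
  - by apply: measurable_funTS; exact: (measurable_marginal_cdfs mUi fU_density).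
move=> _ [u _ <-]; apply: TD; exists (marginal_cdfs U fU u) => //.
exact: (marginal_cdfs_cube mUi fU_density).
Qed.

Lemma measurable_dirt_map j : (j <= k)%N ->
  measurable_fun (box U) (dirt_map U fU T j) /\
  dirt_map U fU T j @` box U `<=` box X.
Proof.
elim: j => [|j IH] jk; first exact: measurable_layer_step layer0.
have [mj Xj] := IH (ltnW jk).
have [mT UT] := measurable_layer_step (layers (j := j.+1) jk).
split; first exact: (measurable_comp mU UT mj mT).
by move=> _ [u Uu <-]; apply: Xj; eexists; last reflexivity; apply: UT; exists u.
Qed.

Lemma measurable_dirt_density j : (j <= k)%N ->
  measurable_fun (box X) (dirt_density om fU gam g S j).
Proof.
move=> jk; have [_ mg0 _ _] := layer0.
apply: measurable_funM.
  by apply: measurable_funD => //; exact: measurable_funX.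
apply: measurable_prod => i; rewrite mem_index_iota => /andP[i1 ij].
have ik : (i.-1 < k)%N by rewrite prednK// (leq_trans _ jk).
have [mS SU _ _] := S_inverse ik.
have [_ mg _ _] : dirt_layer U om (gam i) (g i) (T i).
  by apply: layers; rewrite i1 (leq_trans _ jk).
apply: measurable_funM; last first.
  apply: (measurableT_comp (@measurable_inv R)).
  exact: (measurable_comp mU SU measurable_fU mS).
apply: measurable_funM; last exact: (measurable_comp mU SU (measurable_weight om_weight) mS).
apply: measurable_funD => //; apply: measurable_funX.
exact: (measurable_comp mU SU mg mS).
Qed.

Lemma dirt_density_ge0 j x : (j <= k)%N -> box X x ->
  0 <= dirt_density om fU gam g S j x.
Proof.
move=> jk Xx; have [_ _ c0 _] := layer0.
apply: mulr_ge0; first by rewrite addr_ge0 ?sqr_ge0// ltW.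
rewrite big_seq prodr_ge0// => i; rewrite mem_index_iota => /andP[i1 ij].
have ik : (i.-1 < k)%N by rewrite prednK// (leq_trans _ jk).
have [_ SU _ _] := S_inverse ik.
have Ux : box U (S i.-1 x) by apply: SU; exists x.
have [_ _ ci _] : dirt_layer U om (gam i) (g i) (T i).
  by apply: layers; rewrite i1 (leq_trans _ jk).
rewrite divr_ge0 ?(ltW (fU_gt0 _))// mulr_ge0 ?(ltW (weight_gt0 om_weight _))//.
by rewrite addr_ge0 ?sqr_ge0// ltW.
Qed.

Lemma dirt_densityS j x : dirt_density om fU gam g S j.+1 x =
  dirt_density om fU gam g S j x *
  ((gam j.+1 + g j.+1 (S j x) ^+ 2) * prod_fun om (S j x) / prod_fun fU (S j x)).
Proof. by rewrite /dirt_density [in LHS]big_nat_recr//= mulrA. Qed.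

Lemma dirt_massS j : dirt_mass X U lam om gam g j.+1 =
  dirt_mass X U lam om gam g j * layer_mass U om (gam j.+1) (g j.+1).
Proof. by rewrite /dirt_mass [in LHS]big_nat_recr//= mulrA. Qed.

Hypothesis lam_gt0 : (0 < \int[mu]_(x in box X) (prod_fun lam x)%:E)%E.
Hypothesis om_gt0 : (0 < \int[mu]_(x in box U) (prod_fun om x)%:E)%E.
Hypothesis g0_lty : (\int[mu]_(x in box X) (g 0%N x ^+ 2 * prod_fun lam x)%:E < +oo)%E.
Hypothesis g_lty : forall j, (1 <= j <= k)%N ->
  (\int[mu]_(x in box U) (g j x ^+ 2 * prod_fun om x)%:E < +oo)%E.

Lemma dirt_mass_gt0 j : (j <= k)%N -> 0 < dirt_mass X U lam om gam g j.
Proof.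
move=> jk; have [_ mg0 c0 _] := layer0.
apply: mulr_gt0; first exact: layer_mass_gt0.
rewrite big_seq prodr_gt0// => i; rewrite mem_index_iota => /andP[i1 ij].
have ik : (1 <= i <= k)%N by rewrite i1 (leq_trans _ jk).
have [_ mg c _] := layers ik.
exact: layer_mass_gt0.
Qed.

Lemma integral_layer_step j (D : 'I_d -> set R) (w : 'I_d -> R -> R) c h
    (f : Rn R d -> \bar R) :
  dirt_layer D w c h (T j) -> product_weight D w ->
  (\int[mu]_(x in box D) (h x ^+ 2 * prod_fun w x)%:E < +oo)%E ->
  (0 < \int[mu]_(x in box D) (prod_fun w x)%:E)%E ->
  measurable_fun (box D) f -> (forall x, box D x -> 0 <= f x)%E ->
  (\int[mu]_(u in box U) (f ((T j \o marginal_cdfs U fU) u) * (prod_fun fU u)%:E) =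
   \int[mu]_(x in box D) (f x * (layer_density D w c h x)%:E))%E.
Proof.
move=> [_ mh c0 invT] hw hoo woo mf f0.
have mD : measurable (box D) by have [mE _ _ _] := hw; exact: measurable_box.
have [mT TD _ _] := invT.
rewrite (@integral_marginal_cdfs _ _ U fU mUi fU_density (f \o T j)).
- apply: integral_inverse_rosenblatt invT _ _ => //.
  + exact: measurable_layer_density.
  + exact: layer_density_ge0.
  + exact: integral_layer_density.
- exact: (measurable_comp mD TD mf mT).
- by move=> y cy; apply: f0; apply: TD; exists y.
Qed.

(** The density at stage j+1 has one extra factor, the composite of a function q on U with S_j. This
    factor joins the test function, so the hypothesis at j applies for a general [f]. On U the
    inverse then cancels, q times f_U is the unnormalised density of layer j+1, and the push-forward
    of that layer concludes. *)
Lemma integral_dirt_map j (f : Rn R d -> \bar R) : (j <= k)%N ->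
  measurable_fun (box X) f -> (forall x, box X x -> 0 <= f x)%E ->
  (\int[mu]_(x in box X) (f x * (dirt_density om fU gam g S j x * prod_fun lam x)%:E) =
   (dirt_mass X U lam om gam g j)%:E *
   \int[mu]_(u in box U) (f (dirt_map U fU T j u) * (prod_fun fU u)%:E))%E.
Proof.
elim: j f => [|j IH] f jk mf f0.
  have [_ mg0 c0 _] := layer0.
  have Z0 : 0 < layer_mass X lam (gam 0%N) (g 0%N) by exact: layer_mass_gt0.
  rewrite (integral_layer_step layer0)// /dirt_mass big_geq// mulr1 -ge0_integralZl//; last 3 first.
  - apply: emeasurable_funM => //; apply/measurable_EFinP.
    exact: measurable_layer_density.
  - by move=> x Xx; rewrite mule_ge0 ?f0// lee_fin layer_density_ge0.
  - by rewrite lee_fin ltW.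
  apply: eq_integral => x _; rewrite muleCA -EFinM /layer_density mulrA.
  by rewrite mulfV ?gt_eqF// mul1r /dirt_density big_geq// mulr1.
have layerj := layers (j := j.+1) jk.
have [_ mg c0 _] := layerj.
have goo := g_lty (j := j.+1) jk.
have [mj Xj] := measurable_dirt_map (ltnW jk).
have [mS SU SK _] := S_inverse jk.
have Z0 : 0 < layer_mass U om (gam j.+1) (g j.+1) by exact: layer_mass_gt0.
have mfj : measurable_fun (box U) (f \o dirt_map U fU T j).
  exact: (measurable_comp mX Xj mf mj).
(* The composed map applies the newest layer first, so this layer is integrated out against [f]
   composed with the previous map. *)
rewrite [X in (_ * X)%E](_ : _ = \int[mu]_(u in box U)
    ((f \o dirt_map U fU T j) u * (layer_density U om (gam j.+1) (g j.+1) u)%:E))%E; last first.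
  rewrite -(integral_layer_step layerj)// => u Uu.
  by apply: f0; apply: Xj; exists u.
pose q u := (gam j.+1 + g j.+1 u ^+ 2) * prod_fun om u / prod_fun fU u.
have q0 u : box U u -> 0 <= q u.
  move=> Uu; rewrite divr_ge0 ?(ltW (fU_gt0 _))// mulr_ge0 ?(ltW (weight_gt0 om_weight _))//.
  by rewrite addr_ge0 ?sqr_ge0// ltW.
have mq : measurable_fun (box U) q.
  apply: measurable_funM; last exact: (measurableT_comp (@measurable_inv R) measurable_fU).
  apply: measurable_funM (measurable_weight om_weight).
  by apply: measurable_funD => //; exact: measurable_funX.
have mqS : measurable_fun (box X) (q \o S j) by exact: (measurable_comp mU SU mq mS).
pose H x := (f x * (q (S j x))%:E)%E.
have mH : measurable_fun (box X) H.
  by apply: emeasurable_funM => //; exact/measurable_EFinP.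
have H0 x : box X x -> (0 <= H x)%E.
  by move=> Xx; rewrite mule_ge0 ?f0// lee_fin q0//; apply: SU; exists x.
transitivity (\int[mu]_(x in box X)
    (H x * (dirt_density om fU gam g S j x * prod_fun lam x)%:E))%E.
  apply: eq_integral => x _; rewrite dirt_densityS -/(q (S j x)) /H.
  by rewrite -muleA -EFinM mulrAC [in RHS]mulrC.
rewrite (IH H (ltnW jk) mH H0) dirt_massS.
rewrite [(_ * layer_mass U _ _ _)%:E]EFinM -muleA; congr (_ * _)%E.
rewrite -ge0_integralZl//; last 3 first.
- apply: emeasurable_funM => //; apply/measurable_EFinP.
  exact: measurable_layer_density.
- move=> u Uu; rewrite mule_ge0 ?lee_fin ?layer_density_ge0//.
  by apply: f0; apply: Xj; exists u.
- by rewrite lee_fin ltW.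
apply: ge0_ae_eq_integral => //.
- apply: emeasurable_funM; last by apply/measurable_EFinP; exact: measurable_fU.
  exact: (measurable_comp mX Xj mH mj).
- apply: measurable_funeM; apply: emeasurable_funM => //; apply/measurable_EFinP.
  exact: measurable_layer_density.
- move=> u Uu; rewrite mule_ge0 ?lee_fin ?(ltW (fU_gt0 _))//.
  by apply: H0; apply: Xj; exists u.
- move=> u Uu; rewrite mule_ge0 ?lee_fin ?(ltW Z0)//.
  rewrite mule_ge0 ?lee_fin ?layer_density_ge0//.
  by apply: f0; apply: Xj; exists u.
(* The factor f_U cancels the denominator of [q], and the mass of the layer cancels the inverse mass
   in [layer_density]. *)
apply: filterS SK => u Su Uu; rewrite /H Su// /layer_density /=.
rewrite -muleA [in RHS]muleCA -!EFinM; congr (_ * _%:E)%E.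
by rewrite divfK ?gt_eqF ?fU_gt0// mulrA mulfV ?mul1r// gt_eqF.
Qed.

End composition.

(** * From norm bounds to the error of one layer *)

Section layer_error.
Context (R : realType) (d : nat).
Local Notation mu := (lebesgue_Rn R d).

(** The norm is an extended real: a real bound makes the integral finite and also fixes the sign of
    [e], which later squarings rely on. *)
Lemma L2norm_le D w (f : Rn R d -> R) (e : R) :
  (forall x, D x -> 0 <= w x) -> (L2norm D w f <= e%:E)%E ->
  0 <= e /\ (\int[mu]_(x in D) (f x ^+ 2 * w x)%:E <= (e ^+ 2)%:E)%E.
Proof.
move=> w0; rewrite /L2norm.
have : (0 <= \int[mu]_(x in D) (f x ^+ 2 * w x)%:E)%E.
  by apply: integral_ge0 => x Dx; rewrite lee_fin mulr_ge0 ?sqr_ge0 ?w0.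
case: (\int[mu]_(x in D) _)%E => [r||]//=; rewrite !lee_fin => r0 re.
have e0 : 0 <= e by rewrite (le_trans _ re).
by split=> //; rewrite -(sqr_sqrtr r0) ler_sqr ?nnegrE.
Qed.

Lemma le_L2norm D w (f : Rn R d -> R) (e : R) : 0 <= e ->
  (\int[mu]_(x in D) (f x ^+ 2 * w x)%:E <= (e ^+ 2)%:E)%E ->
  (L2norm D w f <= e%:E)%E.
Proof.
move=> e0; rewrite /L2norm.
case: (\int[mu]_(x in D) _)%E => [r||]//=; rewrite !lee_fin => re.
by rewrite -[leRHS](ger0_norm e0) -sqrtr_sqr ler_wsqrtr.
Qed.

Lemma sqr_L2norm D w (f : Rn R d -> R) : (forall x, D x -> 0 <= w x) ->
  (L2norm D w f ^+ 2 = \int[mu]_(x in D) (f x ^+ 2 * w x)%:E)%E.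
Proof.
move=> w0; apply: sqr_sqrte.
by apply: integral_ge0 => x Dx; rewrite lee_fin mulr_ge0 ?sqr_ge0 ?w0.
Qed.

Variables (D : 'I_d -> set R) (w : 'I_d -> R -> R) (c e : R) (h q : Rn R d -> R).
Hypotheses (hw : product_weight D w) (mh : measurable_fun (box D) h).
Hypotheses (mq : measurable_fun (box D) q) (q0 : forall x, box D x -> 0 <= q x).
Hypothesis hq : (L2norm (box D) (prod_fun w) (fun x => h x - q x)%R <= e%:E)%E.

Let mD : measurable (box D).
Proof. by have [mE _ _ _] := hw; exact: measurable_box. Qed.

Let w0 x : box D x -> 0 <= prod_fun w x.
Proof. by move=> Dx; rewrite ltW// (weight_gt0 hw). Qed.

Let msqr (f : Rn R d -> R) : measurable_fun (box D) f ->
  measurable_fun (box D) (fun x => (f x ^+ 2 * prod_fun w x)%:E).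
Proof.
move=> mf; apply/measurable_EFinP; apply: measurable_funM (measurable_weight hw).
exact: measurable_funX.
Qed.

(** Write h = (h - q) + q and use Minkowski's inequality. Finiteness of the layer mass is thereby a
    consequence of the approximation bound. *)
Lemma sqr_integral_lty :
  (\int[mu]_(x in box D) (q x ^+ 2 * prod_fun w x)%:E < +oo)%E ->
  (\int[mu]_(x in box D) (h x ^+ 2 * prod_fun w x)%:E < +oo)%E.
Proof.
have [e0 hqe] := L2norm_le w0 hq.
set J := (\int[mu]_(x in box D) (q x ^+ 2 * _)%:E)%E => Joo.
have J0 : (0 <= J)%E.
  by apply: integral_ge0 => x Dx; rewrite lee_fin mulr_ge0 ?sqr_ge0 ?w0.
have Jfin : J \is a fin_num by rewrite ge0_fin_numE.
have Jle : (J <= (Num.sqrt (fine J) ^+ 2)%:E)%E.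
  by rewrite sqr_sqrtr ?fine_ge0// fineK.
have := minkowski_sqr mD (measurable_weight hw) w0 (measurable_funB mh mq) mq e0
  (sqrtr_ge0 _) hqe Jle.
under eq_integral do rewrite subrK.
by move=> /le_lt_trans; apply; rewrite ltry.
Qed.

(** With s = sqrt (c + h^2) one has h <= s, and q >= 0 gives q h <= q s, hence (q - s)^2 <= (q -
    h)^2 + c. After integration, the bound on [c] makes the second term at most the first, whence 2
    e^2. *)
Lemma layer_error :
  (0 < \int[mu]_(x in box D) (prod_fun w x)%:E)%E -> 0 < c ->
  (c%:E <= ((mass (box D) (prod_fun w))^-1)%R%:E *
     L2norm (box D) (prod_fun w) (fun x => h x - q x)%R ^+ 2)%E ->
  (\int[mu]_(x in box D) ((q x - Num.sqrt (c + h x ^+ 2)) ^+ 2 * prod_fun w x)%:E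
    <= (2 * e ^+ 2)%:E)%E.
Proof.
move=> w_gt0 c0; rewrite sqr_L2norm// => cI.
have [e0 hqe] := L2norm_le w0 hq.
set I := (\int[mu]_(x in _) _)%E in cI hqe.
have I0 : (0 <= I)%E.
  by apply: integral_ge0 => x Dx; rewrite lee_fin mulr_ge0 ?sqr_ge0 ?w0.
have Ifin : I \is a fin_num by rewrite ge0_fin_numE// (le_lt_trans hqe) ?ltry.
have m0 : 0 < mass (box D) (prod_fun w) by rewrite -lte_fin massE.
(* The bound on [c] multiplied through by the total weight, which is positive. *)
have cm : (c%:E * \int[mu]_(x in box D) (prod_fun w x)%:E <= I)%E.
  rewrite -massE// -(fineK Ifin) -EFinM lee_fin.
  move: cI; rewrite -(fineK Ifin) -EFinM lee_fin.
  by rewrite mulrC ler_pdivlMr// => /le_trans; apply.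
have mw := measurable_weight hw.
have mwE : measurable_fun (box D) (fun x => (prod_fun w x)%:E) by exact/measurable_EFinP.
apply: (@le_trans _ _ (I + c%:E * \int[mu]_(x in box D) (prod_fun w x)%:E)%E); last first.
  by rewrite mulr2n mulrDl mul1r EFinD leeD// (le_trans cm).
rewrite -ge0_integralZl//; last by rewrite lee_fin ltW.
rewrite -ge0_integralD//; last 4 first.
- by move=> x Dx; rewrite lee_fin mulr_ge0 ?sqr_ge0 ?w0.
- by apply: (msqr (f := h \- q)); exact: measurable_funB.
- by move=> x Dx; rewrite mule_ge0 ?lee_fin ?w0// ltW.
- exact: measurable_funeM.
apply: ge0_le_integral => //.
- by move=> x Dx; rewrite lee_fin mulr_ge0 ?sqr_ge0 ?w0.
- apply: (msqr (f := fun x => q x - Num.sqrt (c + h x ^+ 2))); apply: measurable_funB => //.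
  apply: (measurableT_comp (@measurable_sqrt R)).
  by apply: measurable_funD => //; exact: measurable_funX.
- apply: emeasurable_funD; last exact: measurable_funeM.
  by apply: (msqr (f := h \- q)); exact: measurable_funB.
move=> x Dx; rewrite -EFinM -EFinD lee_fin -mulrDl ler_wpM2r ?w0//.
have ch : 0 <= c + h x ^+ 2 by rewrite addr_ge0 ?sqr_ge0// ltW.
have hle : h x <= Num.sqrt (c + h x ^+ 2).
  rewrite (le_trans (ler_norm _))// -sqrtr_sqr ler_wsqrtr// lerDr ltW//.
rewrite !sqrrB sqr_sqrtr//.
have : q x * h x <= q x * Num.sqrt (c + h x ^+ 2) by rewrite ler_wpM2l ?q0.
set s := Num.sqrt _; move: (h x) (q x) => y z; rewrite !mulr2n; nra.
Qed.

End layer_error.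

(** * Ratios of the bridging densities *)

Section bridging.
Context (R : realType) (d L k : nat).
Local Notation mu := (lebesgue_Rn R d).
Variables (X : 'I_d -> set R) (lam : 'I_d -> R -> R) (pi : nat -> Rn R d -> R).
Hypotheses (hk : (k <= L)%N) (hpi : bridging_densities X lam pi L).

Lemma bridging_neq0 : exists x, box X x.
Proof.
have [_ _ z _ _] := hpi; have /andP[+ _] := z 0%N isT.
apply: contraPP => /forallNP nX; apply/negP; rewrite -leNgt.
by rewrite (_ : box X = set0) ?integral_set0// -subset0 => x /nX.
Qed.

Lemma bridge_ratio_ge0 i j x : (i <= L)%N -> (j <= L)%N -> box X x ->
  0 <= bridge_ratio pi i j x.
Proof.
have [_ pi0 _ _ _] := hpi => iL jL Xx.
by rewrite /bridge_ratio; case: eqP => // _; rewrite divr_ge0// pi0.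
Qed.

Lemma measurable_bridge_ratio i j : (i <= L)%N -> (j <= L)%N ->
  measurable_fun (box X) (bridge_ratio pi i j).
Proof.
have [mpi _ _ _ _] := hpi => iL jL; rewrite /bridge_ratio.
case: eqP => // _; apply: measurable_funM; first exact: mpi.
exact: (measurableT_comp (@measurable_inv R) (mpi _ jL)).
Qed.

Lemma bridge_ratio_le i j x : (i <= j)%N -> (j <= L)%N -> box X x ->
  bridge_ratio pi j i x <= bridge_sup X pi j i.
Proof.
move=> ij jL Xx; apply: ub_le_sup; last by exists x.
move: ij; rewrite leq_eqVlt => /predU1P[->|ij].
  by exists 1 => _ [y _ <-]; rewrite /bridge_ratio eqxx.
by have [_ _ _ _] := hpi; apply; rewrite ij.
Qed.

Lemma bridge_sup_ge0 i j : (i <= j)%N -> (j <= L)%N -> 0 <= bridge_sup X pi j i.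
Proof.
move=> ij jL; have [x Xx] := bridging_neq0.
by rewrite (le_trans _ (bridge_ratio_le ij jL Xx))// bridge_ratio_ge0// (leq_trans ij).
Qed.

Lemma bridge_ratio_trans i x : (i < k)%N -> box X x ->
  bridge_ratio pi k i x = bridge_ratio pi k i.+1 x * bridge_ratio pi i.+1 i x.
Proof.
have [_ _ _ pi_neq0 _] := hpi => ik Xx; rewrite /bridge_ratio.
rewrite (gtn_eqF ik) (gtn_eqF (ltnSn i)).
(* When k = i+1 the first ratio is 1 by convention; the quotient could be 0/0 here, because the last
   density may vanish. *)
have [->|ki] := eqVneq k i.+1; first by rewrite mul1r.
by rewrite mulrA divfK// pi_neq0// (leq_trans _ hk)// ltn_neqAle eq_sym ki.
Qed.

End bridging.

(** * Assembly of the error bound *)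

Unset Implicit Arguments.
Theorem theorem4 (R : realType) (d L k : nat)
  (X U : 'I_d -> set R) (lam om fU : 'I_d -> R -> R)
  (pi : nat -> Rn R d -> R)
  (g : nat -> Rn R d -> R) (gam : nat -> R)
  (T S : nat -> Rn R d -> Rn R d) (eps : nat -> R)
  (d_gt0 : (0 < d)%N)
  (k_range : (1 <= k <= L)%N)
  (lam_weight : product_weight X lam)
  (om_weight : product_weight U om)
  (fU_density : product_probability_density U fU)
  (pi_bridging : bridging_densities X lam pi L)
  (layer0 : dirt_layer X lam (gam 0%N) (g 0%N) (T 0%N))
  (layers : forall j, (1 <= j <= k)%N -> dirt_layer U om (gam j) (g j) (T j))
  (S_inverse : forall j, (j < k)%N ->
     ae_inverse (box U) (box X) (dirt_map U fU T j) (S j))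
  (approx0 : (L2norm (box X) (prod_fun lam)
                (fun x => g 0%N x - Num.sqrt (pi 0%N x))%R <= (eps 0%N)%:E)%E)
  (gam0_le : ((gam 0%N)%:E <= ((mass (box X) (prod_fun lam))^-1)%R%:E *
                L2norm (box X) (prod_fun lam)
                  (fun x => g 0%N x - Num.sqrt (pi 0%N x))%R ^+ 2)%E)
  (approx : forall j, (1 <= j <= k)%N ->
     (L2norm (box U) (prod_fun om)
        (fun u => g j u - ratio_target U om fU pi T j u)%R <= (eps j)%:E)%E)
  (gam_le : forall j, (1 <= j <= k)%N ->
     ((gam j)%:E <= ((mass (box U) (prod_fun om))^-1)%R%:E *
        L2norm (box U) (prod_fun om)
          (fun u => g j u - ratio_target U om fU pi T j u)%R ^+ 2)%E) :
  (L2norm (box X) (prod_fun lam)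
     (fun x => Num.sqrt (pi k x) - Num.sqrt (dirt_density om fU gam g S k x))%R
   <= (Num.sqrt (2 * bridge_sup X pi k 0) * eps 0%N +
       \sum_(1 <= j < k.+1)
          Num.sqrt (2 * bridge_sup X pi k j *
                    dirt_mass X U lam om gam g j.-1) * eps j)%R%:E)%E.
Proof.
have /andP[k1 kL] := k_range.
have [mpi pi0 z pi_neq0 _] := pi_bridging.
have mX : measurable (box X) by have [mE _ _ _] := lam_weight; exact: measurable_box.
have mU : measurable (box U) by have [mE _ _ _] := om_weight; exact: measurable_box.
have lam0 x : box X x -> 0 < prod_fun lam x by exact: weight_gt0.
have om0 x : box U x -> 0 < prod_fun om x by exact: weight_gt0.
have f0 x : box U x -> 0 < prod_fun fU x by exact: fU_gt0.
have mlam := measurable_weight lam_weight.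
have mom := measurable_weight om_weight.
have mfU := measurable_fU om_weight fU_density.
have mfUE : measurable_fun (box U) (fun u => (prod_fun fU u)%:E) by exact/measurable_EFinP.
have lam_gt0 : (0 < \int[lebesgue_Rn R d]_(x in box X) (prod_fun lam x)%:E)%E.
  have /andP[+ _] := z 0%N isT; apply: integral_gt0_of_gt0 => //.
  by apply/measurable_EFinP; apply: measurable_funM => //; exact: mpi.
(* The reference density has mass 1 on U, so U is not null and its positive weight has positive
   mass. *)
have om_gt0 : (0 < \int[lebesgue_Rn R d]_(x in box U) (prod_fun om x)%:E)%E.
  apply: (integral_gt0_of_gt0 mU mom om0 mfUE).
  by rewrite (integral_fU om_weight fU_density) lte01.
have mdirt j : (j <= k)%N -> measurable_fun (box U) (dirt_map U fU T j) /\
    dirt_map U fU T j @` box U `<=` box X.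
  exact: (measurable_dirt_map om_weight fU_density layer0 layers).
have mq0 : measurable_fun (box X) (fun x => Num.sqrt (pi 0%N x)).
  by apply: (measurableT_comp (@measurable_sqrt R)); exact: mpi.
have target_sqr j u : (1 <= j <= k)%N -> box U u ->
    ratio_target U om fU pi T j u ^+ 2 * prod_fun om u =
    bridge_ratio pi j j.-1 (dirt_map U fU T j.-1 u) * prod_fun fU u.
  move=> /andP[j1 jk] Uu; have j1k : (j.-1 <= k)%N by rewrite (leq_trans (leq_pred j)).
  have [_ UX] := mdirt _ j1k.
  have Xu : box X (dirt_map U fU T j.-1 u) by apply: UX; exists u.
  rewrite sqr_sqrtr ?divfK ?gt_eqF ?om0//.
  rewrite divr_ge0 ?(ltW (om0 _ _))// mulr_ge0 ?(ltW (f0 _ _))//.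
  by apply: (bridge_ratio_ge0 pi_bridging) => //; rewrite (leq_trans _ kL).
have mq j : (1 <= j <= k)%N -> measurable_fun (box U) (ratio_target U om fU pi T j).
  move=> /andP[j1 jk]; have j1k : (j.-1 <= k)%N by rewrite (leq_trans (leq_pred j)).
  have [mj UX] := mdirt _ j1k.
  apply: (measurableT_comp (@measurable_sqrt R)).
  apply: measurable_funM; last exact: (measurableT_comp (@measurable_inv R) mom).
  apply: measurable_funM => //; apply: (measurable_comp mX UX _ mj).
  by apply: (measurable_bridge_ratio pi_bridging); rewrite (leq_trans _ kL).
have g0_lty : (\int[lebesgue_Rn R d]_(x in box X) (g 0%N x ^+ 2 * prod_fun lam x)%:E < +oo)%E.
  have [_ mg0 _ _] := layer0.
  apply: (sqr_integral_lty lam_weight mg0 mq0 approx0).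
  have /andP[_] := z 0%N isT; congr (_ < _)%E; apply: eq_integral => x /set_mem Xx.
  by rewrite sqr_sqrtr// pi0.
have g_lty j : (1 <= j <= k)%N ->
    (\int[lebesgue_Rn R d]_(x in box U) (g j x ^+ 2 * prod_fun om x)%:E < +oo)%E.
  move=> jk; have [_ mg _ _] := layers j jk.
  apply: (sqr_integral_lty om_weight mg (mq j jk) (approx j jk)).
  have /andP[j1 jk'] := jk.
  have jL : (j <= L)%N by rewrite (leq_trans jk').
  have [_ UX] := mdirt j.-1 (leq_trans (leq_pred j) jk').
  (* The squared target times omega equals r_(j,j-1) along the map times f_U, hence is at most
     c_(j,j-1) f_U, which has finite integral. *)
  apply: (@le_lt_trans _ _ (\int[lebesgue_Rn R d]_(u in box U)
    ((bridge_sup X pi j j.-1)%:E * (prod_fun fU u)%:E))%E); last first.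
    rewrite ge0_integralZl//.
    - by rewrite (integral_fU om_weight fU_density) mule1 ltry.
    - by move=> u Uu; rewrite lee_fin ltW// f0.
    - by rewrite lee_fin (bridge_sup_ge0 pi_bridging)// leq_pred.
  apply: ge0_le_integral => //.
  - by move=> u Uu; rewrite lee_fin mulr_ge0 ?sqr_ge0// ltW// om0.
  - apply/measurable_EFinP; apply: measurable_funM => //.
    by apply: measurable_funX; exact: mq.
  - exact: measurable_funeM.
  move=> u Uu; rewrite target_sqr// -EFinM lee_fin ler_wpM2r ?(ltW (f0 _ Uu))//.
  by apply: (bridge_ratio_le pi_bridging) => //; [exact: leq_pred|apply: UX; exists u].
pose dd := dirt_density om fU gam g S.
pose dm := dirt_mass X U lam om gam g.
have dm0 j : (j <= k)%N -> 0 < dm j.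
  exact: (dirt_mass_gt0 lam_weight om_weight layer0 layers lam_gt0 om_gt0).
have mdd j : (j <= k)%N -> measurable_fun (box X) (dd j).
  exact: (measurable_dirt_density om_weight fU_density layer0 layers S_inverse).
have dd0 j x : (j <= k)%N -> box X x -> 0 <= dd j x.
  exact: (dirt_density_ge0 om_weight fU_density layer0 layers S_inverse).
have eps0 j : (j <= k)%N -> 0 <= eps j.
  case: j => [_|j jk].
    exact: (L2norm_le (fun x Xx => ltW (lam0 x Xx)) approx0).1.
  exact: (L2norm_le (fun x Xx => ltW (om0 x Xx)) (approx j.+1 jk)).1.
have sup0 j : (j <= k)%N -> 0 <= bridge_sup X pi k j.
  by move=> jk; exact: (bridge_sup_ge0 pi_bridging).
pose rho j x := Num.sqrt (bridge_ratio pi k j x).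
have mrho j : (j <= k)%N -> measurable_fun (box X) (rho j).
  move=> jk; apply: (measurableT_comp (@measurable_sqrt R)).
  by apply: (measurable_bridge_ratio pi_bridging) => //; rewrite (leq_trans jk).
have rho_sqr j x : (j <= k)%N -> box X x -> rho j x ^+ 2 <= bridge_sup X pi k j.
  move=> jk Xx; rewrite sqr_sqrtr; first exact: (bridge_ratio_le pi_bridging).
  by apply: (bridge_ratio_ge0 pi_bridging) => //; rewrite (leq_trans jk).
have msqrt (f : Rn R d -> R) : measurable_fun (box X) f ->
    measurable_fun (box X) (fun x => Num.sqrt (f x)).
  exact: (measurableT_comp (@measurable_sqrt R)).
have rho_int j (f : Rn R d -> R) (e : R) : (j <= k)%N -> measurable_fun (box X) f ->
    (forall x, box X x -> 0 <= f x) ->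
    (\int[lebesgue_Rn R d]_(x in box X) (f x * prod_fun lam x)%:E <= (2 * e ^+ 2)%:E)%E ->
    (\int[lebesgue_Rn R d]_(x in box X) ((rho j x ^+ 2 * f x) * prod_fun lam x)%:E
      <= ((Num.sqrt (2 * bridge_sup X pi k j) * e) ^+ 2)%:E)%E.
  move=> jk mf fx0 fe.
  have mfl : measurable_fun (box X) (fun x => f x * prod_fun lam x).
    exact: measurable_funM.
  have c0 : (0 <= (bridge_sup X pi k j)%:E)%E by rewrite lee_fin sup0.
  rewrite exprMn sqr_sqrtr ?mulr_ge0 ?sup0// mulrAC mulrC EFinM.
  apply: le_trans (lee_wpmul2l c0 fe).
  rewrite -ge0_integralZl//; last 2 first.
  - exact/measurable_EFinP.
  - by move=> x Xx; rewrite lee_fin mulr_ge0 ?fx0// ltW// lam0.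
  apply: ge0_le_integral => //.
  - move=> x Xx; rewrite lee_fin mulr_ge0 ?(ltW (lam0 _ Xx))//.
    by rewrite mulr_ge0 ?sqr_ge0 ?fx0.
  - apply/measurable_EFinP; apply: measurable_funM => //; apply: measurable_funM => //.
    by apply: measurable_funX; exact: mrho.
  - by apply: measurable_funeM; exact/measurable_EFinP.
  move=> x Xx; rewrite -EFinM lee_fin -mulrA ler_wpM2r ?rho_sqr//.
  by rewrite mulr_ge0 ?fx0// ltW// lam0.
(* The weighted form of the error, with [k] fixed in the weight; for m = k the weight is 1 and the
   claim is the theorem. *)
have main m : (m <= k)%N ->
    (\int[lebesgue_Rn R d]_(x in box X)
      ((rho m x * (Num.sqrt (pi m x) - Num.sqrt (dd m x))) ^+ 2 * prod_fun lam x)%:E <=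
     ((Num.sqrt (2 * bridge_sup X pi k 0) * eps 0%N +
       \sum_(1 <= j < m.+1) Num.sqrt (2 * bridge_sup X pi k j * dm j.-1) * eps j) ^+ 2)%:E)%E.
  elim: m => [_|m IH mk].
    rewrite big_geq// addr0; under eq_integral do rewrite exprMn.
    have [_ mg0 c0 _] := layer0.
    apply: rho_int => //.
    - apply: measurable_funX; apply: measurable_funB => //; apply: msqrt; exact: mdd.
    - by move=> x _; exact: sqr_ge0.
    have := layer_error lam_weight mg0 mq0 (fun x _ => sqrtr_ge0 _) approx0 lam_gt0 c0 gam0_le.
    apply: le_trans; rewrite le_eqVlt; apply/orP; left; apply/eqP.
    by apply: eq_integral => x _; rewrite /dd /dirt_density big_geq// mulr1.
  have mk' : (m <= k)%N := ltnW mk.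
  have mL : (m < L)%N := leq_trans mk kL.
  have layerm := layers m.+1 mk; have [_ mg c0 _] := layerm.
  have [mj UX] := mdirt m mk'.
  have [mS SU SK _] := S_inverse m mk.
  pose qh u := (gam m.+1 + g m.+1 u ^+ 2) * prod_fun om u / prod_fun fU u.
  have qh0 u : box U u -> 0 <= qh u.
    move=> Uu; rewrite divr_ge0 ?(ltW (f0 _ Uu))// mulr_ge0 ?(ltW (om0 _ Uu))//.
    by rewrite addr_ge0 ?sqr_ge0// ltW.
  have mqh : measurable_fun (box U) qh.
    apply: measurable_funM; last exact: (measurableT_comp (@measurable_inv R) mfU).
    apply: measurable_funM => //.
    by apply: measurable_funD => //; exact: measurable_funX.
  have mqS : measurable_fun (box X) (qh \o S m) by exact: (measurable_comp mU SU mqh mS).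
  have mr : measurable_fun (box X) (bridge_ratio pi m.+1 m).
    by apply: (measurable_bridge_ratio pi_bridging) => //; exact: ltnW.
  have r0 x : box X x -> 0 <= bridge_ratio pi m.+1 m x.
    by move=> Xx; apply: (bridge_ratio_ge0 pi_bridging) => //; exact: ltnW.
  pose F x := (Num.sqrt (bridge_ratio pi m.+1 m x) - Num.sqrt (qh (S m x))) ^+ 2.
  have mF : measurable_fun (box X) F.
    apply: measurable_funX; apply: measurable_funB; first exact: msqrt.
    exact: (msqrt (qh \o S m)).
  (* Moving the integral to U produces the factor [dm m], and the integrand becomes that of
     [layer_error] for layer m+1. *)
  have Fint : (\int[lebesgue_Rn R d]_(x in box X) (dd m x * F x * prod_fun lam x)%:E <=
      (2 * (Num.sqrt (dm m) * eps m.+1) ^+ 2)%:E)%E.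
    have err := layer_error om_weight mg (mq m.+1 mk) (fun x _ => sqrtr_ge0 _)
      (approx m.+1 mk) om_gt0 c0 (gam_le m.+1 mk).
    have dmE0 : (0 <= (dm m)%:E)%E by rewrite lee_fin ltW// dm0.
    rewrite exprMn sqr_sqrtr ?(ltW (dm0 _ mk'))// mulrCA EFinM.
    apply: le_trans (lee_wpmul2l dmE0 err).
    rewrite (eq_integral (fun x => (F x)%:E * (dd m x * prod_fun lam x)%:E)%E); last first.
      by move=> x _; rewrite -EFinM -mulrA mulrCA.
    rewrite (integral_dirt_map lam_weight om_weight fU_density layer0 layers S_inverse
      lam_gt0 om_gt0 g0_lty g_lty (f := fun x => (F x)%:E) mk'); last 2 first.
    - exact/measurable_EFinP.
    - by move=> x _; rewrite lee_fin sqr_ge0.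
    rewrite le_eqVlt; apply/orP; left; apply/eqP; congr (_ * _)%E.
    apply: ge0_ae_eq_integral => //.
    - apply: emeasurable_funM => //.
      have mFE : measurable_fun (box X) (fun x => (F x)%:E) by exact/measurable_EFinP.
      exact: (measurable_comp mX UX mFE mj).
    - apply/measurable_EFinP; apply: measurable_funM => //; apply: measurable_funX.
      apply: measurable_funB; first exact: mq.
      apply: (measurableT_comp (@measurable_sqrt R)).
      by apply: measurable_funD => //; exact: measurable_funX.
    - by move=> u Uu; rewrite -EFinM lee_fin mulr_ge0 ?sqr_ge0// ltW// f0.
    - by move=> u Uu; rewrite lee_fin mulr_ge0 ?sqr_ge0// ltW// om0.
    apply: filterS SK => u Su Uu; rewrite /F Su// -EFinM; congr (_%:E).
    have Xu : box X (dirt_map U fU T m u) by apply: UX; exists u.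
    have A0 : 0 <= gam m.+1 + g m.+1 u ^+ 2 by rewrite addr_ge0 ?sqr_ge0// ltW.
    have fE := sqr_sqrtr (ltW (f0 u Uu)).
    have oE := sqr_sqrtr (ltW (om0 u Uu)).
    have s0 : Num.sqrt (prod_fun fU u) != 0 by rewrite gt_eqF// sqrtr_gt0 f0.
    have t0 : Num.sqrt (prod_fun om u) != 0 by rewrite gt_eqF// sqrtr_gt0 om0.
    rewrite /qh /ratio_target /= !sqrtrM ?mulr_ge0 ?r0 ?(ltW (f0 u Uu)) ?(ltW (om0 u Uu))//.
    rewrite !sqrtrV ?(ltW (f0 u Uu)) ?(ltW (om0 u Uu))//.
    (* Both f_U and omega are rewritten as squares of their roots, so that the identity is rational
       in these roots. *)
    rewrite -{2}fE -{3}oE.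
    by field; rewrite s0 t0.
  (* The new error made at layer m+1. Adding it to the weighted error at stage m gives the weighted
     error at stage m+1. *)
  pose B x := rho m.+1 x * (Num.sqrt (dd m x) *
    (Num.sqrt (bridge_ratio pi m.+1 m x) - Num.sqrt (qh (S m x)))).
  have mB : measurable_fun (box X) B.
    apply: measurable_funM; first exact: mrho.
    apply: measurable_funM; first by apply: msqrt; exact: mdd.
    apply: measurable_funB; first exact: msqrt.
    exact: (msqrt (qh \o S m)).
  have Bint : (\int[lebesgue_Rn R d]_(x in box X) (B x ^+ 2 * prod_fun lam x)%:E <=
      ((Num.sqrt (2 * bridge_sup X pi k m.+1 * dm m) * eps m.+1) ^+ 2)%:E)%E.
    (* Splitting off the root of [dm m] matches the constant with [rho_int] at e = sqrt (dm m) *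
       eps_(m+1). *)
    rewrite sqrtrM ?mulr_ge0 ?sup0// -mulrA.
    have ddF0 x : box X x -> 0 <= dd m x * F x.
      by move=> Xx; rewrite mulr_ge0 ?sqr_ge0 ?dd0.
    have mddF : measurable_fun (box X) (fun x => dd m x * F x).
      by apply: measurable_funM => //; exact: mdd.
    apply: le_trans (rho_int m.+1 _ _ mk mddF ddF0 Fint).
    rewrite le_eqVlt; apply/orP; left; apply/eqP; apply: eq_integral => x /set_mem Xx.
    by rewrite /B !exprMn (sqr_sqrtr (dd0 _ _ mk' Xx)).
  rewrite big_nat_recr//= addrA.
  have merr : measurable_fun (box X) (fun x => rho m x * (Num.sqrt (pi m x) - Num.sqrt (dd m x))).
    apply: measurable_funM; first exact: mrho.
    by apply: measurable_funB; apply: msqrt; [apply: mpi; exact: ltnW|exact: mdd].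
  have sum0 : 0 <= Num.sqrt (2 * bridge_sup X pi k 0) * eps 0%N +
      \sum_(1 <= j < m.+1) Num.sqrt (2 * bridge_sup X pi k j * dm j.-1) * eps j.
    rewrite addr_ge0//; first by rewrite mulr_ge0 ?sqrtr_ge0 ?eps0.
    rewrite big_nat sumr_ge0// => j /andP[_ jm].
    by rewrite mulr_ge0 ?sqrtr_ge0 ?eps0// (leq_trans _ mk')// -ltnS.
  have last0 : 0 <= Num.sqrt (2 * bridge_sup X pi k m.+1 * dm m) * eps m.+1.
    by rewrite mulr_ge0 ?sqrtr_ge0 ?eps0.
  apply: le_trans (minkowski_sqr mX mlam (fun x Xx => ltW (lam0 x Xx)) merr mB
    sum0 last0 (IH mk') Bint).
  rewrite le_eqVlt; apply/orP; left; apply/eqP; apply: eq_integral => x /set_mem Xx.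
  congr (_ ^+ 2 * _)%:E.
  have Ux : box U (S m x) by apply: SU; exists x.
  have rk : rho m x = rho m.+1 x * Num.sqrt (bridge_ratio pi m.+1 m x).
    rewrite /rho (bridge_ratio_trans kL pi_bridging)// sqrtrM//.
    by apply: (bridge_ratio_ge0 pi_bridging) => //.
  (* The division is legitimate because m < L, and only the density of index L may vanish. *)
  have pim : Num.sqrt (pi m.+1 x) = Num.sqrt (bridge_ratio pi m.+1 m x) * Num.sqrt (pi m x).
    by rewrite -sqrtrM ?r0// /bridge_ratio (gtn_eqF (ltnSn m)) divfK// pi_neq0.
  have ddm : Num.sqrt (dd m.+1 x) = Num.sqrt (dd m x) * Num.sqrt (qh (S m x)).
    by rewrite /dd dirt_densityS sqrtrM// dd0.
  rewrite /B rk pim ddm; ring.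
have := main k (leqnn k).
set E := _ + _ => errk.
have E0 : 0 <= E.
  rewrite addr_ge0//; first by rewrite mulr_ge0 ?sqrtr_ge0 ?eps0.
  rewrite /= big_nat sumr_ge0// => j /andP[_ jm].
  by rewrite mulr_ge0 ?sqrtr_ge0 ?eps0.
apply: le_L2norm => //; apply: le_trans errk.
rewrite le_eqVlt; apply/orP; left; apply/eqP; apply: eq_integral => x _.
by rewrite /rho /bridge_ratio eqxx sqrtr1 mul1r.
Qed.
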